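(* Let $I$ be a set, let $(T_i)_{i\in I}$ be an orthonormal basis of $OH(I)$ and let $(a_i)_{i\in I}$ be a finitely supported family of elements of $B(\ell_2)$. Then $$\Big\|\sum_{i} T_i\otimes a_i\Big\|_{OH(I)\otimes_{\min}B(\ell_2)}=\Big\|\sum_i a_i\otimes\overline{a_i}\Big\|^{1/2}_{B(\ell_2)\otimes_{\min}B(\overline{\ell_2})}.$$
   Context: All spaces are complex. An operator space is a Banach space $E$ given with an isometric embedding as a closed subspace of some $B(H)$, $H$ a Hilbert space; $M_n(E)$ is normed as a subspace of $M_n(B(H))=B(H\oplus\cdots\oplus H)$. For linear $u:E\to F$, $\|u\|_{cb}=\sup_n\|(a_{ij})\mapsto(u(a_{ij}))\|_{M_n(E)\to M_n(F)}$, $cb(E,F)$ is the space of maps with $\|u\|_{cb}<\infty$, and $u$ is a complete isometry if all these maps $M_n(E)\to M_n(F)$ are isometric. The dual $E^*$ is an operator space with $M_n(E^* )=cb(E,M_n)$. The complex conjugate $\overline{E}$ is the same Banach space with scalar multiplication $\lambda\cdot x=\overline{\lambda}x$ and operator space structure induced by $\overline{E}\subset\overline{B(H)}=B(\overline{H})$; for $a\in B(H)$, $\overline a$ denotes $a$ viewed as an element of $\overline{B(H)}=B(\overline H)$. For $E\subset B(H)$, $F\subset B(K)$, $E\otimes_{\min}F$ is the completion of $E\otimes F$ for the norm induced by $B(H\otimes K)$, $H\otimes K$ being the Hilbertian tensor product. $OH(I)$ denotes the operator space, unique up to complete isometry, which is isometric to $\ell_2(I)$ as a Banach space and for which the natural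 linear identification $x\mapsto\langle\cdot,x\rangle$ from $OH(I)$ to its antidual $\overline{OH(I)^*}$ is a complete isometry. *)

(* Defs.v *)
From HB Require Import structures.
From mathcomp Require Import all_boot all_order all_algebra.
From mathcomp Require Import all_classical all_reals.
From mathcomp Require Import ereal topology normedtype sequences esum.
From mathcomp Require Import ring lra.
From mathcomp Require Import sesquilinear finmap complex.

Set Implicit Arguments.
Unset Strict Implicit.
Unset Printing Implicit Defensive.
Import Order.TTheory GRing.Theory Num.Theory numFieldNormedType.Exports.
Local Open Scope classical_set_scope.
Local Open Scope ring_scope.

(* The norm of a normed module over R[i] takes its values in R[i];
   rnorm is the same norm, as an element of R. *)
Definition rnorm (R : realType) (V : normedModType R[i]) (x : V) : R :=
  complex.Re `|x|.

Lemma rnormE (R : realType) (V : normedModType R[i]) (x : V) :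
  `|x| = (rnorm x)%:C%C.
Proof. by rewrite /rnorm RRe_real// normr_real. Qed.

(* Inner products are linear in the first variable and antilinear in the
   second one. *)
HB.mixin Record CompleteNormedModule_isHilbert (R : realType) V
    & CompleteNormedModule R[i] V := {
  inner : V -> V -> R[i] ;
  inner_linearl : forall z, linear_for *%R (inner^~ z) ;
  innerC : forall x y, inner y x = (inner x y)^* ;
  inner_norm : forall x, inner x x = `|x| ^+ 2
}.

#[short(type="hilbertType")]
HB.structure Definition Hilbert (R : realType) :=
  {V of CompleteNormedModule R[i] V & CompleteNormedModule_isHilbert R V}.

Lemma sqr_ltC (R : realType) (x : R[i]) (e : R) : 0 <= x -> 0 < e ->
  (x ^+ 2 < e%:C%C) = (x < (Num.sqrt e)%:C%C).
Proof.
move=> x0 e0; rewrite -{1}(sqr_sqrtr (ltW e0)) rmorphXn/= ltr_pXn2r ?nnegrE//.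
by rewrite ler0c sqrtr_ge0.
Qed.

Lemma sesqui_cauchy_schwarz (R : realType) (V : lmodType R[i])
    (f : V -> V -> R[i]) :
  (forall z, linear_for *%R (f^~ z)) -> (forall x y, f y x = (f x y)^*) ->
  (forall x, 0 <= f x x) -> (forall x, f x x = 0 -> x = 0) ->
  forall x y, `|f x y| <= sqrtC (f x x) * sqrtC (f y y).
Proof.
move=> flin fC fge0 feq0 x y.
have fDl x1 x2 z : f (x1 + x2) z = f x1 z + f x2 z.
  by have := flin z 1 x1 x2; rewrite scale1r mul1r.
have f0l z : f 0 z = 0 by apply: (addrI (f 0 z)); rewrite -fDl !addr0.
have fZl a x1 z : f (a *: x1) z = a * f x1 z.
  by have := flin z a x1 0; rewrite !addr0 f0l addr0.
have fDr x1 x2 z : f z (x1 + x2) = f z x1 + f z x2.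
  by rewrite fC fDl rmorphD/= -!fC.
have fZr a x1 z : f z (a *: x1) = a^* * f z x1.
  by rewrite fC fZl rmorphM/= -fC.
have [y0|y0] := eqVneq (f y y) 0.
  by rewrite y0 sqrtC0 mulr0 (feq0 _ y0) fC f0l conjC0 normr0.
have yp : 0 < f y y by rewrite lt_def y0 fge0.
rewrite -(@ler_pXn2r _ 2)// ?nnegrE ?mulr_ge0 ?sqrtC_ge0//.
rewrite exprMn !sqrtCK normCK -fC.
have := fge0 (f y y *: x - f x y *: y).
rewrite -scaleNr fDl !fDr !fZl !fZr rmorphN/= -!fC.
rewrite (_ : _ + _ = f y y * (f x x * f y y - f x y * f y x)); last by ring.
by rewrite pmulr_rge0// subr_ge0.
Qed.

HB.factory Record Lmodule_isHilbert (R : realType) V & GRing.Lmodule R[i] V := {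
  inner : V -> V -> R[i] ;
  inner_linearl : forall z, linear_for *%R (inner^~ z) ;
  innerC : forall x y, inner y x = (inner x y)^* ;
  inner_ge0 : forall x, 0 <= inner x x ;
  inner_eq0 : forall x, inner x x = 0 -> x = 0 ;
  inner_complete : forall u : nat -> V,
    (forall e : R, 0 < e -> exists N, forall m n, (N <= m)%N -> (N <= n)%N ->
       inner (u m - u n) (u m - u n) < e%:C%C) ->
    exists l, forall e : R, 0 < e -> exists N, forall n, (N <= n)%N ->
       inner (u n - l) (u n - l) < e%:C%C
}.

HB.builders Context R V & Lmodule_isHilbert R V.

Local Notation "''[' u , v ]" := (inner u v).

Let innerDl x y z : '[x + y, z] = '[x, z] + '[y, z].
Proof. by have := inner_linearl z 1 x y; rewrite scale1r mul1r. Qed.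
Let inner0l z : '[0, z] = 0.
Proof. by apply: (addrI '[0, z]); rewrite -innerDl !addr0. Qed.
Let innerZl a x z : '[a *: x, z] = a * '[x, z].
Proof. by have := inner_linearl z a x 0; rewrite !addr0 inner0l addr0. Qed.
Let innerDr x y z : '[z, x + y] = '[z, x] + '[z, y].
Proof. by rewrite innerC innerDl rmorphD/= -!innerC. Qed.
Let innerZr a x z : '[z, a *: x] = a^* * '[z, x].
Proof. by rewrite innerC innerZl rmorphM/= -innerC. Qed.

Let norm (x : V) : R[i] := sqrtC '[x, x].

Let norm_sqr x : norm x ^+ 2 = '[x, x]. Proof. exact: sqrtCK. Qed.
Let norm_ge0 x : 0 <= norm x. Proof. by rewrite sqrtC_ge0 inner_ge0. Qed.

Let normrZ (l : R[i]) (x : V) : norm (l *: x) = `|l| * norm x.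
Proof.
apply/eqP; rewrite -(@eqrXn2 _ 2)// ?norm_ge0 ?mulr_ge0 ?norm_ge0//.
by rewrite exprMn !norm_sqr innerZl innerZr mulrA normCK.
Qed.

Let normr0_eq0 (x : V) : norm x = 0 -> x = 0.
Proof. by move=> /eqP; rewrite sqrtC_eq0 => /eqP/inner_eq0. Qed.

Let cauchy_schwarz x y : `|'[x, y]| <= norm x * norm y.
Proof.
exact: sesqui_cauchy_schwarz inner_linearl innerC inner_ge0 inner_eq0 x y.
Qed.

Let norm_triangle x y : norm (x + y) <= norm x + norm y.
Proof.
rewrite -(@ler_pXn2r _ 2)// ?nnegrE ?addr_ge0 ?norm_ge0//.
have -> : norm (x + y) ^+ 2 =
    '[x, x] + '[y, y] + ('[x, y] + ('[x, y])^*).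
  by rewrite norm_sqr innerDl !innerDr -(innerC x y); ring.
have -> : (norm x + norm y) ^+ 2 =
    '[x, x] + '[y, y] + (norm x * norm y + norm x * norm y).
  by rewrite -!norm_sqr; ring.
rewrite lerD2l; apply: le_trans (lerD (cauchy_schwarz x y) (cauchy_schwarz x y)).
rewrite -{2}(norm_conjC '[x, y]); apply: le_trans (ler_normD _ _).
apply: real_ler_norm; rewrite CrealE rmorphD/= conjCK addrC.
exact: eqxx.
Qed.

HB.instance Definition _ := @Lmodule_isNormed.Build R[i] V norm
  norm_triangle normrZ normr0_eq0.

Let cauchy_cvg (F : set_system V) : ProperFilter F -> cauchy F -> cvg F.
Proof.
move=> FF /cauchyP Fc.
have /choice[u uF] (n : nat) : exists x, F (ball x (n.+1%:R^-1 : R[i])).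
  by apply: Fc; rewrite invr_gt0 ltr0n.
have small (e : R) : 0 < e -> exists N, forall n, (N <= n)%N ->
    (n.+1%:R^-1 : R[i]) < e%:C%C.
  move=> e0; have [N] := ltr_add_invr e0; rewrite add0r => Ne.
  exists N => n Nn; rewrite -(rmorph_nat (real_complex R)) -fmorphV/= ltcR.
  by apply: le_lt_trans Ne; rewrite lef_pV2 ?posrE ?ltr0n// ler_nat.
have sqrtP (x : V) (e : R) : 0 < e ->
    (inner x x < e%:C%C) = (`|x| < (Num.sqrt e)%:C%C).
  by move=> e0; rewrite -norm_sqr sqr_ltC// norm_ge0.
have [|l ul] := @inner_complete u.
  move=> e e0; have [|N Ne] := small (Num.sqrt e / 2).
    by rewrite divr_gt0 ?sqrtr_gt0.
  exists N => m n Nm Nn; rewrite sqrtP//.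
  have [x []] := @filter_ex _ F _ _ (filterI (uF m) (uF n)).
  rewrite -!ball_normE/= => umx unx.
  rewrite (splitr (Num.sqrt e)) rmorphD/= -(subrKA x).
  rewrite (le_lt_trans (ler_normD _ _))// ltrD//.
    by rewrite (lt_trans umx)// Ne.
  by rewrite distrC (lt_trans unx)// Ne.
apply/cvg_ex; exists l; apply/cvgrPdist_lt => e e0.
have eR : e = (complex.Re e)%:C%C by rewrite RRe_real// gtr0_real.
have re0 : 0 < complex.Re e by rewrite -ltcR -eR.
set r := complex.Re e / 2; have r0 : 0 < r by rewrite divr_gt0.
have [N1 HN1] := small r r0.
have [N2 HN2] := ul (r ^+ 2) (exprn_gt0 _ r0).
pose n := maxn N1 N2.
have unl : `|u n - l| < r%:C%C.
  by have := HN2 n (leq_maxr _ _); rewrite sqrtP ?exprn_gt0// sqrtr_sqr gtr0_norm.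
apply: filterS (uF n) => x; rewrite -ball_normE/= => unx.
rewrite eR (splitr (complex.Re e)) rmorphD/= -(subrKA (u n)).
rewrite (le_lt_trans (ler_normD _ _))// ltrD//; first by rewrite distrC.
by rewrite (lt_trans unx)// HN1// leq_maxl.
Qed.

HB.instance Definition _ := Uniform_isComplete.Build V cauchy_cvg.

HB.instance Definition _ := CompleteNormedModule_isHilbert.Build R V
  inner_linearl innerC (fun x => esym (norm_sqr x)).

HB.end.

Section unordered_sums.
Variables (R : realType) (I : choiceType).
Implicit Types (f g p q : I -> R) (x y : I -> R[i]).

(* Sum of a family of nonnegative reals. *)
Definition nnsum f : \bar R := \esum_(i in [set: I]) (f i)%:E.

(* Sum of an absolutely summable family, as the difference of the sums of its
   positive and negative parts. *)
Definition rsum f : R :=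
  fine (nnsum (fun i => Num.max (f i) 0)) -
  fine (nnsum (fun i => Num.max (- f i) 0)).

Definition csum x : R[i] :=
  (rsum (fun i => complex.Re (x i)) +i* rsum (fun i => complex.Im (x i)))%C.

Definition abs_summable f := (nnsum (fun i => `|f i|%R) < +oo)%E.

Lemma nnsum_ge0 f : (forall i, 0 <= f i) -> (0 <= nnsum f)%E.
Proof. by move=> f0; apply: esum_ge0 => i _; rewrite lee_fin. Qed.

Lemma le_nnsum f g : (forall i, f i <= g i) -> (nnsum f <= nnsum g)%E.
Proof. by move=> fg; apply: le_esum => i _; rewrite lee_fin. Qed.

Lemma nnsumD f g : (forall i, 0 <= f i) -> (forall i, 0 <= g i) ->
  (nnsum (fun i => (f i + g i)%R) = nnsum f + nnsum g)%E.
Proof. by move=> f0 g0; rewrite -esumD// => i _; rewrite lee_fin. Qed.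

Lemma nnsum_fsetP f (M : R) : (nnsum f <= M%:E)%E <->
  forall A : set I, finite_set A -> \sum_(i \in A) f i <= M.
Proof.
split=> [fM A fA|H].
  rewrite -lee_fin; apply: le_trans fM; rewrite -fsumEFin//.
  by apply: ereal_sup_ubound; exists A.
apply: ge_ereal_sup => _ [A [fA _] <-].
by rewrite fsumEFin// lee_fin; exact: H.
Qed.

Lemma nnsum_ge f i : (forall i, 0 <= f i) -> ((f i)%:E <= nnsum f)%E.
Proof.
move=> f0; apply: ereal_sup_ubound; exists [set i]; first by split.
by rewrite fsbig_set1.
Qed.

Lemma nnsumZ_le f (a : R) : 0 <= a -> (forall i, 0 <= f i) ->
  (nnsum (fun i => (a * f i)%R) <= a%:E * nnsum f)%E.
Proof.
move=> a0 f0; apply: ge_ereal_sup => _ [A [fA _] <-].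
rewrite fsumEFin// -mulr_fsumr// EFinM lee_wpmul2l ?lee_fin//.
by rewrite -fsumEFin//; apply: ereal_sup_ubound; exists A.
Qed.

Lemma nnsum_fin f : (forall i, 0 <= f i) -> (nnsum f < +oo)%E ->
  nnsum f \is a fin_num.
Proof. by move=> f0 foo; rewrite ge0_fin_numE// nnsum_ge0. Qed.

Lemma rsumB p q f : (forall i, 0 <= p i) -> (forall i, 0 <= q i) ->
  (nnsum p < +oo)%E -> (nnsum q < +oo)%E -> (forall i, f i = p i - q i) ->
  rsum f = fine (nnsum p) - fine (nnsum q).
Proof.
move=> p0 q0 poo qoo fpq; rewrite /rsum.
set fp := fun i => Num.max (f i) 0; set fn := fun i => Num.max (- f i) 0.
have fp0 i : 0 <= fp i by rewrite /fp le_max lexx orbT.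
have fn0 i : 0 <= fn i by rewrite /fn le_max lexx orbT.
have fpp i : fp i <= p i.
  by rewrite /fp fpq ge_max p0 andbT; have := q0 i; lra.
have fnq i : fn i <= q i.
  by rewrite /fn fpq ge_max q0 andbT; have := p0 i; lra.
have Pfin := nnsum_fin p0 poo; have Qfin := nnsum_fin q0 qoo.
have FPfin := nnsum_fin fp0 (le_lt_trans (le_nnsum fpp) poo).
have FNfin := nnsum_fin fn0 (le_lt_trans (le_nnsum fnq) qoo).
have : (nnsum fp + nnsum q = nnsum p + nnsum fn)%E.
  rewrite -!nnsumD//; congr nnsum; apply/funext => i; rewrite /fp /fn fpq.
  by case: (leP (p i - q i) 0) => ?; case: (leP (- (p i - q i)) 0) => ?; lra.
move/(congr1 fine); rewrite !fineD// => ?; lra.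
Qed.

Lemma nnsum0 : nnsum (cst 0) = 0%E.
Proof. by rewrite /nnsum esum1. Qed.

Lemma rsumE f : (forall i, 0 <= f i) -> (nnsum f < +oo)%E ->
  rsum f = fine (nnsum f).
Proof.
move=> f0 foo; rewrite (@rsumB f (cst 0))// ?nnsum0 ?subr0//.
by move=> i; rewrite subr0.
Qed.

Lemma nnsumZ f (a : R) : 0 <= a -> (forall i, 0 <= f i) ->
  (nnsum f < +oo)%E -> (nnsum (fun i => (a * f i)%R) = a%:E * nnsum f)%E.
Proof.
rewrite le_eqVlt => /predU1P[<- f0 _|a0 f0 foo].
  by under eq_fun do rewrite mul0r; rewrite nnsum0 mul0e.
apply/eqP; rewrite eq_le nnsumZ_le//= ?(ltW a0)//.
have af0 i : 0 <= a * f i by rewrite mulr_ge0// ltW.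
have afoo : (nnsum (fun i => (a * f i)%R) < +oo)%E.
  apply: le_lt_trans (nnsumZ_le (ltW a0) f0) _.
  by rewrite -(fineK (nnsum_fin f0 foo)) -EFinM ltry.
have ai0 : 0 <= a^-1 by rewrite invr_ge0 ltW.
have := nnsumZ_le ai0 af0.
under eq_fun do rewrite mulrA mulVf ?gt_eqF// mul1r.
rewrite -(fineK (nnsum_fin f0 foo)) -(fineK (nnsum_fin af0 afoo)).
by rewrite -!EFinM !lee_fin ler_pdivlMl.
Qed.

Lemma abs_summable_le f g : (forall i, `|f i| <= g i) -> (nnsum g < +oo)%E ->
  abs_summable f.
Proof. by move=> fg; apply: le_lt_trans; exact: le_nnsum. Qed.

Lemma abs_summableD f g : abs_summable f -> abs_summable g ->
  abs_summable (fun i => f i + g i).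
Proof.
move=> fs gs; apply: (@abs_summable_le _ (fun i => `|f i| + `|g i|)).
  by move=> i; exact: ler_normD.
by rewrite nnsumD// lte_add_pinfty.
Qed.

Lemma abs_summableZ a f : abs_summable f -> abs_summable (fun i => a * f i).
Proof.
move=> fs; apply: (@abs_summable_le _ (fun i => `|a| * `|f i|)).
  by move=> i; rewrite normrM.
rewrite nnsumZ// -(@fineK _ (nnsum _)) -?EFinM ?ltry//.
by apply: nnsum_fin.
Qed.

Lemma abs_summableN f : abs_summable f -> abs_summable (fun i => - f i).
Proof.
by rewrite /abs_summable (_ : (fun i => `|- f i|) = (fun i => `|f i|))//;
  apply/funext => i; rewrite normrN.
Qed.

Let pos f i := Num.max (f i) 0.
Let neg f i := Num.max (- f i) 0.
Let pos0 f i : 0 <= pos f i. Proof. by rewrite le_max lexx orbT. Qed.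
Let neg0 f i : 0 <= neg f i. Proof. by rewrite le_max lexx orbT. Qed.
Let posB f i : f i = pos f i - neg f i.
Proof. by rewrite /pos /neg; case: ltP => ?; case: ltP => ?; lra. Qed.
Let pos_fin f : abs_summable f -> (nnsum (pos f) < +oo)%E.
Proof.
by apply: le_lt_trans; apply: le_nnsum => i; rewrite ge_max ler_norm normr_ge0.
Qed.
Let neg_fin f : abs_summable f -> (nnsum (neg f) < +oo)%E.
Proof.
apply: le_lt_trans; apply: le_nnsum => i.
by rewrite ge_max -normrN ler_norm normr_ge0.
Qed.

Lemma rsumD f g : abs_summable f -> abs_summable g ->
  rsum (fun i => f i + g i) = rsum f + rsum g.
Proof.
move=> fs gs; have := pos_fin fs; have := pos_fin gs.
have := neg_fin fs; have := neg_fin gs => ? ? ? ?.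
rewrite (@rsumB (fun i => pos f i + pos g i) (fun i => neg f i + neg g i)).
- rewrite !nnsumD// !fineD ?nnsum_fin// /rsum -/(pos f) -/(pos g).
  by rewrite -/(neg f) -/(neg g); lra.
- by move=> i; rewrite addr_ge0.
- by move=> i; rewrite addr_ge0.
- by rewrite nnsumD// lte_add_pinfty.
- by rewrite nnsumD// lte_add_pinfty.
- by move=> i; rewrite [f i]posB [g i]posB; lra.
Qed.

Lemma rsumN f : abs_summable f -> rsum (fun i => - f i) = - rsum f.
Proof.
move=> fs; rewrite (@rsumB (neg f) (pos f))// ?opprB//.
- exact: neg_fin.
- exact: pos_fin.
- by move=> i; rewrite {1}[f i]posB opprB.
Qed.

Lemma rsumZ a f : abs_summable f -> rsum (fun i => a * f i) = a * rsum f.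
Proof.
wlog a0 : a / 0 <= a => [hw fs|fs].
  have [a0|a0] := leP 0 a; first exact: hw.
  under eq_fun do rewrite -[_ * _]opprK -mulNr.
  rewrite rsumN ?hw// ?mulNr ?opprK ?oppr_ge0 ?ltW//.
  exact: abs_summableZ.
have := pos_fin fs; have := neg_fin fs => ? ?.
rewrite (@rsumB (fun i => a * pos f i) (fun i => a * neg f i)).
- by rewrite !nnsumZ// !fineM ?nnsum_fin// mulrBr.
- by move=> i; rewrite mulr_ge0.
- by move=> i; rewrite mulr_ge0.
- by rewrite nnsumZ// -(fineK (nnsum_fin _ (pos_fin fs)))// -EFinM ltry.
- by rewrite nnsumZ// -(fineK (nnsum_fin _ (neg_fin fs)))// -EFinM ltry.
- by move=> i; rewrite {1}[f i]posB mulrBr.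
Qed.

Definition csummable x := abs_summable (fun i => complex.Re (x i)) /\
  abs_summable (fun i => complex.Im (x i)).

Lemma csum_linear a x y : csummable x -> csummable y ->
  csum (fun i => a * x i + y i) = a * csum x + csum y.
Proof.
move=> [xr xi] [yr yi]; case: a => a b.
have reE i : complex.Re ((a +i* b)%C * x i + y i) =
    a * complex.Re (x i) + (- b) * complex.Im (x i) + complex.Re (y i).
  by case: (x i) (y i) => [? ?] [? ?] /=; ring.
have imE i : complex.Im ((a +i* b)%C * x i + y i) =
    a * complex.Im (x i) + b * complex.Re (x i) + complex.Im (y i).
  by case: (x i) (y i) => [? ?] [? ?] /=; ring.
rewrite /csum (funext reE) (funext imE).
have xs k : abs_summable (fun i => k * complex.Re (x i)) by exact: abs_summableZ.
have ys k : abs_summable (fun i => k * complex.Im (x i)) by exact: abs_summableZ.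
rewrite !rsumD ?rsumZ//; [|exact: abs_summableD|exact: abs_summableD].
by apply/eqP; rewrite eq_complex/=; apply/andP; split; apply/eqP; ring.
Qed.

Lemma csum_conj x : csummable x -> csum (fun i => (x i)^*) = (csum x)^*.
Proof.
move=> [_ xi]; rewrite /csum -[RHS]/(_ -i* _)%C -rsumN//.
have reE i : complex.Re (x i)^* = complex.Re (x i) by case: (x i).
have imE i : complex.Im (x i)^* = - complex.Im (x i) by case: (x i).
by congr Complex; congr rsum; apply/funext => i.
Qed.
End unordered_sums.

Section ell2.
Variables (R : realType) (I : choiceType).

(* |z| ^ 2 *)
Definition abs2 (z : R[i]) : R := complex.Re z ^+ 2 + complex.Im z ^+ 2.

Definition ell2_pred : {pred I -> R[i]} :=
  mem [set x : I -> R[i] | (nnsum (fun i => abs2 (x i)) < +oo)%E].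

Record ell2 := Ell2 { ell2_fun :> I -> R[i]; _ : ell2_fun \in ell2_pred }.

HB.instance Definition _ := [isSub for ell2_fun].
HB.instance Definition _ := [Choice of ell2 by <:].

Lemma abs2_ge0 z : 0 <= abs2 z. Proof. by rewrite addr_ge0 ?sqr_ge0. Qed.

Lemma abs2M z w : abs2 (z * w) = abs2 z * abs2 w.
Proof. by case: z w => [? ?] [? ?]; rewrite /abs2/=; ring. Qed.

Lemma abs2D_le z w : abs2 (z + w) <= 2 * (abs2 z + abs2 w).
Proof.
case: z w => [a b] [c d]; rewrite /abs2/= -subr_ge0.
rewrite (_ : _ - _ = (a - c) ^+ 2 + (b - d) ^+ 2); last by ring.
by rewrite addr_ge0 ?sqr_ge0.
Qed.

Lemma ell2_submod_closed : submod_closed ell2_pred.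
Proof.
split=> [|a x y].
  by apply: mem_set; rewrite /= (_ : (fun=> _) = cst 0) ?nnsum0//; apply/funext => i; rewrite /abs2 [complex.Re _]/(0 : R) [complex.Im _]/(0 : R) expr0n addr0.
move=> /set_mem/= xs /set_mem/= ys; apply: mem_set => /=.
apply: (@le_lt_trans _ _ (nnsum (fun i =>
   2 * abs2 a * abs2 (x i) + 2 * abs2 (y i)))).
  apply: le_nnsum => i; apply: (le_trans (abs2D_le _ _)).
  by rewrite abs2M mulrDr mulrA.
rewrite nnsumD ?nnsumZ ?mulr_ge0 ?abs2_ge0//.
- by rewrite lte_add_pinfty// lte_mul_pinfty// lee_fin ?mulr_ge0 ?abs2_ge0.
- by move=> i; exact: abs2_ge0.
- by move=> i; exact: abs2_ge0.
- by move=> i; rewrite mulr_ge0 ?mulr_ge0 ?abs2_ge0.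
- by move=> i; rewrite mulr_ge0 ?abs2_ge0.
Qed.

HB.instance Definition _ :=
  GRing.isSubmodClosed.Build _ _ ell2_pred ell2_submod_closed.
HB.instance Definition _ := [SubChoice_isSubLmodule of ell2 by <:].

End ell2.

Section ell2_hilbert.
Variables (R : realType) (I : choiceType).
Implicit Types x y : ell2 R I.

Lemma ell2P x : (nnsum (fun i => abs2 (x i)) < +oo)%E.
Proof. by case: x => f /= /set_mem. Qed.

Lemma csummable_ell2 x y : csummable (fun i => x i * (y i)^*).
Proof.
have fin : (nnsum (fun i => (abs2 (x i) + abs2 (y i))%R) < +oo)%E.
  by rewrite nnsumD ?lte_add_pinfty ?ell2P// => i; exact: abs2_ge0.
split; apply: abs_summable_le fin => i; case: (x i) (y i) => [a b] [c d];
  rewrite /abs2/= ler_norml; apply/andP; split;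
  have := (sqr_ge0 (a - c), sqr_ge0 (a + c), sqr_ge0 (b - d), sqr_ge0 (b + d),
           sqr_ge0 (a - d), sqr_ge0 (a + d), sqr_ge0 (b - c), sqr_ge0 (b + c),
           (sqr_ge0 a, sqr_ge0 b, sqr_ge0 c, sqr_ge0 d));
  rewrite !expr2 => -[[[[[[[[? ?] ?] ?] ?] ?] ?] ?] [[[? ?] ?] ?]]; lra.
Qed.

Definition ell2_inner x y : R[i] := csum (fun i => x i * (y i)^*).

Lemma ell2_inner_linearl z : linear_for *%R (ell2_inner^~ z).
Proof.
move=> a x y; rewrite -csum_linear; do ?exact: csummable_ell2.
by congr csum; apply/funext => i; rewrite mulrA -mulrDl.
Qed.

Lemma ell2_innerC x y : ell2_inner y x = (ell2_inner x y)^*.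
Proof.
rewrite -csum_conj; last exact: csummable_ell2.
by congr csum; apply/funext => i; rewrite rmorphM/= conjCK mulrC.
Qed.

Let N2 x : R := fine (nnsum (fun i => abs2 (x i))).

Lemma ell2_innerE x : ell2_inner x x = (N2 x)%:C%C.
Proof.
rewrite /ell2_inner /csum.
have reE i : complex.Re (x i * (x i)^*) = abs2 (x i).
  by case: (x i) => a b; rewrite /abs2/=; ring.
have imE i : complex.Im (x i * (x i)^*) = 0.
  by case: (x i) => a b /=; ring.
rewrite (funext reE) (funext imE) !rsumE ?nnsum0 ?ltry//.
- by move=> i; exact: abs2_ge0.
- exact: ell2P.
Qed.

Let N2_ge x i : abs2 (x i) <= N2 x.
Proof.
rewrite -lee_fin fineK.
  by apply: (@nnsum_ge _ _ (fun i => abs2 (x i))) => j; exact: abs2_ge0.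
by apply: nnsum_fin; [move=> j; exact: abs2_ge0|exact: ell2P].
Qed.

Lemma ell2_inner_ge0 x : 0 <= ell2_inner x x.
Proof.
by rewrite ell2_innerE ler0c fine_ge0// nnsum_ge0// => i; exact: abs2_ge0.
Qed.

Lemma ell2_inner_eq0 x : ell2_inner x x = 0 -> x = 0.
Proof.
rewrite ell2_innerE => /complexI x0; apply/val_inj/funext => i /=.
have := N2_ge x i; rewrite x0 => xi.
have : abs2 (x i) == 0 by rewrite eq_le xi abs2_ge0.
rewrite paddr_eq0 ?sqr_ge0// !sqrf_eq0; case: (x i) => a b /=.
by move=> /andP[/eqP -> /eqP ->].
Qed.

Lemma cauchy_seq_cvg (v : nat -> R) :
  (forall e, 0 < e -> exists N, forall m n, (N <= m)%N -> (N <= n)%N ->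
     (v m - v n) ^+ 2 < e) -> exists l : R, v n @[n --> \oo] --> l.
Proof.
move=> vc; suff : cvg (v n @[n --> \oo]) by move=> /cvg_ex.
apply/cauchy_cvgP/cauchyP => e e0.
have [N vN] := vc _ (exprn_gt0 2 e0).
exists (v N); exists N => // n /= Nn; rewrite -ball_normE/=.
by have := vN N n (leqnn _) Nn; rewrite -(ltr_pXn2r (n := 2)) ?nnegrE ?(ltW e0)// real_normK ?num_real.
Qed.

Lemma ell2_complete (u : nat -> ell2 R I) :
  (forall e : R, 0 < e -> exists N, forall m n, (N <= m)%N -> (N <= n)%N ->
     ell2_inner (u m - u n) (u m - u n) < e%:C%C) ->
  exists l, forall e : R, 0 < e -> exists N, forall n, (N <= n)%N ->
     ell2_inner (u n - l) (u n - l) < e%:C%C.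
Proof.
move=> uc.
have {}uc (e : R) : 0 < e -> exists N, forall m n, (N <= m)%N -> (N <= n)%N ->
    N2 (u m - u n) < e.
  move=> e0; have [N uN] := uc e e0; exists N => m n Nm Nn.
  by have := uN m n Nm Nn; rewrite ell2_innerE ltcR.
have /choice[a ua] i : exists l : R, complex.Re (u n i) @[n --> \oo] --> l.
  apply: cauchy_seq_cvg => e /uc[N uN]; exists N => m n Nm Nn.
  apply: le_lt_trans (uN m n Nm Nn); apply: le_trans (N2_ge _ i).
  rewrite [X in abs2 X]/(u m i - u n i) /abs2.
  by case: (u m i) (u n i) => [? ?] [? ?] /=; rewrite lerDl sqr_ge0.
have /choice[b ub] i : exists l : R, complex.Im (u n i) @[n --> \oo] --> l.
  apply: cauchy_seq_cvg => e /uc[N uN]; exists N => m n Nm Nn.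
  apply: le_lt_trans (uN m n Nm Nn); apply: le_trans (N2_ge _ i).
  rewrite [X in abs2 X]/(u m i - u n i) /abs2.
  by case: (u m i) (u n i) => [? ?] [? ?] /=; rewrite lerDr sqr_ge0.
pose l0 : I -> R[i] := fun i => (a i +i* b i)%C.
have lim_le (e : R) : 0 < e -> exists N, forall n, (N <= n)%N ->
    (nnsum (fun i => abs2 (u n i - l0 i)%R) <= e%:E)%E.
  move=> /uc[N uN]; exists N => n Nn; apply/nnsum_fsetP => A fA.
  have cv : \sum_(i <- fset_set A) abs2 (u n i - u m i) @[m --> \oo] -->
      \sum_(i <- fset_set A) abs2 (u n i - l0 i).
    apply: cvg_big => [|i _]; first exact: add_continuous.
    rewrite /abs2.
    have E1 m : complex.Re (u n i - u m i) = complex.Re (u n i) - complex.Re (u m i).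
      by case: (u n i) (u m i) => [? ?] [? ?].
    have E2 m : complex.Im (u n i - u m i) = complex.Im (u n i) - complex.Im (u m i).
      by case: (u n i) (u m i) => [? ?] [? ?].
    have -> : complex.Re (u n i - l0 i) = complex.Re (u n i) - a i.
      by case: (u n i).
    have -> : complex.Im (u n i - l0 i) = complex.Im (u n i) - b i.
      by case: (u n i).
    have ca : complex.Re (u n i) - complex.Re (u m i) @[m --> \oo] -->
        complex.Re (u n i) - a i by apply: cvgB; [exact: cvg_cst|exact: ua].
    have cb : complex.Im (u n i) - complex.Im (u m i) @[m --> \oo] -->
        complex.Im (u n i) - b i by apply: cvgB; [exact: cvg_cst|exact: ub].
    rewrite (_ : (fun m => _) = (fun m =>
      (complex.Re (u n i) - complex.Re (u m i)) * (complex.Re (u n i) - complex.Re (u m i)) +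
      (complex.Im (u n i) - complex.Im (u m i)) * (complex.Im (u n i) - complex.Im (u m i)))).
      by rewrite !expr2; apply: cvgD; apply: cvgM.
    by apply/funext => m; rewrite E1 E2 !expr2.
  rewrite fsbig_finite//=; apply: (cvgr_to_le cv).
  exists N => // m /= Nm.
  have /nnsum_fsetP/(_ A fA) : (nnsum (fun i => abs2 ((u n - u m)%R i)) <= (N2 (u n - u m)%R)%:E)%E.
    rewrite fineK// nnsum_fin//; last exact: ell2P.
    by move=> i; exact: abs2_ge0.
  rewrite fsbig_finite//= => /le_trans; apply; exact/ltW/uN.
have [N0 uN0] := lim_le 1 ltr01.
have d_in : (fun i => u N0 i - l0 i) \in @ell2_pred R I.
  by apply/mem_set => /=; apply: le_lt_trans (uN0 _ (leqnn _)) _; rewrite ltry.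
pose l : ell2 R I := u N0 - Ell2 d_in.
have lE i : l i = l0 i.
  rewrite -[RHS](subKr (u N0 i)); by [].

exists l => e e0; have [|N uN] := lim_le (e / 2); first by rewrite divr_gt0.
exists N => n /uN un; rewrite ell2_innerE ltcR.
apply: (@le_lt_trans _ _ (e / 2)); last by lra.
rewrite -lee_fin fineK; last first.
  by apply: nnsum_fin; [move=> j; exact: abs2_ge0|exact: ell2P].
by apply: le_trans un; apply: le_nnsum => i; rewrite -lE.
Qed.

HB.instance Definition _ := Lmodule_isHilbert.Build R (ell2 R I)
  ell2_inner_linearl ell2_innerC ell2_inner_ge0 ell2_inner_eq0 ell2_complete.

Lemma inner_ell2E x y : inner x y = csum (fun i => x i * (y i)^*).
Proof. by []. Qed.

End ell2_hilbert.


Section rnorm_theory.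
Variables (R : realType) (V : normedModType R[i]).
Implicit Types x y : V.

Lemma rnorm_ge0 x : 0 <= rnorm x.
Proof. by rewrite -ler0c -rnormE. Qed.

Lemma rnorm0 : rnorm (0 : V) = 0.
Proof. by rewrite /rnorm normr0. Qed.

Lemma rnorm0_eq0 x : rnorm x = 0 -> x = 0.
Proof. by move=> x0; apply/normr0_eq0; rewrite rnormE x0. Qed.

Lemma ler_rnormD x y : rnorm (x + y) <= rnorm x + rnorm y.
Proof. by rewrite -lecR rmorphD/= -!rnormE ler_normD. Qed.

Lemma rnormZ (a : R[i]) x : rnorm (a *: x) = complex.Re `|a| * rnorm x.
Proof.
have aE : `|a| = (complex.Re `|a|)%:C%C by rewrite RRe_real ?normr_real.
by apply: complexI; rewrite -rnormE normrZ {1}aE rnormE -rmorphM.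
Qed.

Lemma rnormZr (a : R) x : 0 <= a -> rnorm (a%:C%C *: x) = a * rnorm x.
Proof. by move=> a0; rewrite rnormZ ger0_norm ?ler0c. Qed.

End rnorm_theory.

Section bounded_operators.
Variables (R : realType) (V W : normedModType R[i]).

Definition bop_pred : {pred V -> W} :=
  mem [set f : V -> W | linear f /\
                        exists M : R, forall x, rnorm (f x) <= M * rnorm x].

(* Bounded linear operators; bop H H is B(H) and bop V R[i]^o is the dual of V. *)
Record bop := Bop { bop_fun :> V -> W; _ : bop_fun \in bop_pred }.

HB.instance Definition _ := [isSub for bop_fun].
HB.instance Definition _ := [Choice of bop by <:].

Lemma bopP (T : bop) : linear T /\
  exists M : R, forall x, rnorm (T x) <= M * rnorm x.
Proof. by case: T => f /= /set_mem. Qed.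

Definition mk_bop (f : V -> W) (fl : linear f) (M : R)
    (fM : forall x, rnorm (f x) <= M * rnorm x) : bop :=
  Bop (mem_set (conj fl (ex_intro _ M fM))).

Lemma bop_submod_closed : submod_closed bop_pred.
Proof.
split=> [|a f g].
  apply: mem_set; split=> [b x y|]; first by rewrite scaler0 addr0.
  by exists 0 => x; rewrite mul0r rnorm0.
move=> /set_mem[fl [M fM]] /set_mem[gl [N gN]].
apply: mem_set; split=> [b x y|].
  rewrite -[LHS]/(a *: f (b *: x + y) + g (b *: x + y)).
  rewrite -[RHS]/(b *: (a *: f x + g x) + (a *: f y + g y)) fl gl.
  by rewrite !scalerDr !scalerA mulrC addrACA.
exists (complex.Re `|a| * M + N) => x.
rewrite -[X in rnorm X]/(a *: f x + g x) (le_trans (ler_rnormD _ _))//.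
rewrite mulrDl lerD// rnormZ -mulrA ler_wpM2l//.
by rewrite -ler0c RRe_real ?normr_real.
Qed.

HB.instance Definition _ :=
  GRing.isSubmodClosed.Build _ _ bop_pred bop_submod_closed.
HB.instance Definition _ := [SubChoice_isSubLmodule of bop by <:].

HB.instance Definition _ (T : bop) :=
  GRing.isLinear.Build R[i] V W *:%R T (proj1 (bopP T)).

Definition opnorm (T : bop) : R :=
  sup [set rnorm (T x) | x in [set x | rnorm x <= 1]].

Lemma opnorm_has_sup (T : bop) :
  has_sup [set rnorm (T x) | x in [set x | rnorm x <= 1]].
Proof.
split; first by exists (rnorm (T 0)); exists 0 => //=; rewrite rnorm0.
have [_ [M TM]] := bopP T; exists `|M| => _ [x /= x1 <-].
rewrite (le_trans (TM x))// (le_trans (ler_norm _))// normrM.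
by rewrite ler_piMr// ger0_norm ?rnorm_ge0.
Qed.

Lemma opnorm_ge0 (T : bop) : 0 <= opnorm T.
Proof.
apply: (@le_trans _ _ (rnorm (T 0))); first exact: rnorm_ge0.
apply: sup_upper_bound; first exact: opnorm_has_sup.
by exists 0 => //=; rewrite rnorm0.
Qed.

Lemma rnorm_bop (T : bop) x : rnorm (T x) <= opnorm T * rnorm x.
Proof.
have [x0|x0] := eqVneq (rnorm x) 0.
  by rewrite (rnorm0_eq0 x0) linear0 !rnorm0 mulr0.
have xp : 0 < rnorm x by rewrite lt_def x0 rnorm_ge0.
rewrite -ler_pdivrMr// mulrC -rnormZr ?invr_ge0 ?(ltW xp)//.
have <- : T ((rnorm x)^-1%:C%C *: x) = (rnorm x)^-1%:C%C *: T x.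
  exact: linearZ.
apply: sup_upper_bound; first exact: opnorm_has_sup.
exists ((rnorm x)^-1%:C%C *: x) => //=.
by rewrite rnormZr ?invr_ge0 ?(ltW xp)// mulVf.
Qed.

Lemma opnorm_le (T : bop) M : 0 <= M ->
  (forall x, rnorm (T x) <= M * rnorm x) -> opnorm T <= M.
Proof.
move=> M0 TM; apply: ge_sup; first by case: (opnorm_has_sup T).
by move=> _ [x /= x1 <-]; rewrite (le_trans (TM x))// ler_piMr.
Qed.

Let norm (T : bop) : R[i] := (opnorm T)%:C%C.

Let norm_triangle S T : norm (S + T) <= norm S + norm T.
Proof.
rewrite -rmorphD/= lecR; apply: opnorm_le => [|x].
  by rewrite addr_ge0 ?opnorm_ge0.
rewrite -[X in rnorm X]/(S x + T x) (le_trans (ler_rnormD _ _))//.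
by rewrite mulrDl lerD// rnorm_bop.
Qed.

Let normZ_le a T : opnorm (a *: T) <= complex.Re `|a| * opnorm T.
Proof.
have a0 : 0 <= complex.Re `|a| by rewrite -ler0c RRe_real ?normr_real.
apply: opnorm_le => [|x]; first by rewrite mulr_ge0 ?opnorm_ge0.
by rewrite -[X in rnorm X]/(a *: T x) rnormZ -mulrA ler_wpM2l// rnorm_bop.
Qed.

Let normZ a T : norm (a *: T) = `|a| * norm T.
Proof.
have aE : `|a| = (complex.Re `|a|)%:C%C by rewrite RRe_real ?normr_real.
rewrite [in RHS]aE -rmorphM; congr (_%:C%C); apply/eqP.
rewrite eq_le normZ_le andTb; have [->|a0] := eqVneq a 0.
  by rewrite normr0 mul0r opnorm_ge0.
have ap : 0 < complex.Re `|a| by rewrite -ltcR -aE normr_gt0.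
rewrite mulrC -ler_pdivlMr// mulrC -{1}[T](scalerK a0).
apply: le_trans (normZ_le _ _) _; rewrite le_eqVlt; apply/orP; left.
apply/eqP; congr (_ * _); apply: complexI.
by rewrite RRe_real ?normr_real// normfV aE fmorphV.
Qed.

Let norm_eq0 T : norm T = 0 -> T = 0.
Proof.
move=> /complexI T0; apply/val_inj/funext => x /=; apply: rnorm0_eq0.
by apply/eqP; rewrite eq_le rnorm_ge0 andbT (le_trans (rnorm_bop _ _))// T0 mul0r.
Qed.

HB.instance Definition _ := @Lmodule_isNormed.Build R[i] bop norm
  norm_triangle normZ norm_eq0.

Lemma bop_normE (T : bop) : `|T| = (opnorm T)%:C%C. Proof. by []. Qed.

End bounded_operators.

(* Same vectors, with the scalar multiplication a . x := a^* *: x. *)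
Definition conjugate (V : Type) : Type := V.

Section conjugate_lmodule.
Variables (R : realType) (V : lmodType R[i]).

HB.instance Definition _ := GRing.Zmodule.copy (conjugate V) V.

Let scale (a : R[i]) (x : conjugate V) : conjugate V := a^* *: (x : V).

Let scaleA a b x : scale a (scale b x) = scale (a * b) x.
Proof. by rewrite /scale scalerA rmorphM. Qed.
Let scale1 : left_id 1 scale.
Proof. by move=> x; rewrite /scale conjC1 scale1r. Qed.
Let scaleDr : right_distributive scale +%R.
Proof. by move=> a x y; rewrite /scale scalerDr. Qed.
Let scaleDl x : {morph scale^~ x : a b / a + b}.
Proof. by move=> a b; rewrite /scale rmorphD/= scalerDl. Qed.

HB.instance Definition _ := GRing.Zmodule_isLmodule.Build R[i] (conjugate V)
  scaleA scale1 scaleDr scaleDl.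

End conjugate_lmodule.

Section hilbert_theory.
Variables (R : realType) (V : hilbertType R).
Implicit Types x y z : V.

Lemma innerDl x y z : inner (x + y) z = inner x z + inner y z.
Proof. by have := inner_linearl z 1 x y; rewrite scale1r mul1r. Qed.
Lemma inner0l z : inner 0 z = 0.
Proof. by apply: (addrI (inner 0 z)); rewrite -innerDl !addr0. Qed.
Lemma innerZl a x z : inner (a *: x) z = a * inner x z.
Proof. by have := inner_linearl z a x 0; rewrite !addr0 inner0l addr0. Qed.
Lemma innerDr x y z : inner z (x + y) = inner z x + inner z y.
Proof. by rewrite innerC innerDl rmorphD/= -!innerC. Qed.
Lemma innerZr a x z : inner z (a *: x) = a^* * inner z x.
Proof. by rewrite innerC innerZl rmorphM/= -innerC. Qed.

Lemma cauchy_schwarz x y : `|inner x y| <= `|x| * `|y|.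
Proof.
have := @sesqui_cauchy_schwarz R V inner inner_linearl innerC _ _ x y.
rewrite !inner_norm !sqrCK//; apply=> z; rewrite inner_norm ?exprn_ge0//.
by move=> /eqP; rewrite sqrf_eq0 normr_eq0 => /eqP.
Qed.

End hilbert_theory.

Section conjugate_hilbert.
Variables (R : realType) (V : hilbertType R).

Let cinner (x y : conjugate V) : R[i] := inner (y : V) (x : V).

Let cinner_linearl z : linear_for *%R (cinner^~ z).
Proof. by move=> a x y; rewrite /cinner innerDr innerZr conjCK. Qed.

Let cinnerC x y : cinner y x = (cinner x y)^*.
Proof. exact: innerC. Qed.

Let cinner_ge0 x : 0 <= cinner x x.
Proof. by rewrite /cinner inner_norm exprn_ge0. Qed.

Let cinner_eq0 x : cinner x x = 0 -> x = 0.
Proof. by rewrite /cinner inner_norm => /eqP; rewrite sqrf_eq0 normr_eq0 => /eqP. Qed.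

Let cinner_complete (u : nat -> conjugate V) :
  (forall e : R, 0 < e -> exists N, forall m n, (N <= m)%N -> (N <= n)%N ->
     cinner (u m - u n) (u m - u n) < e%:C%C) ->
  exists l, forall e : R, 0 < e -> exists N, forall n, (N <= n)%N ->
     cinner (u n - l) (u n - l) < e%:C%C.
Proof.
move=> uc; pose v : nat -> V := u.
have cR (e : R[i]) : 0 < e -> e = (complex.Re e)%:C%C.
  by move=> e0; rewrite RRe_real ?gtr0_real.
have : cvg (v n @[n --> \oo]).
  apply/cauchy_cvgP/cauchyP => e e0.
  have r0 : 0 < complex.Re e by rewrite -ltcR -cR.
  have [N uN] := uc _ (exprn_gt0 2 r0).
  exists (v N); exists N => // n /= Nn; rewrite -ball_normE/= (cR e e0).
  have := uN N n (leqnn _) Nn; rewrite /cinner inner_norm sqr_ltC ?exprn_gt0//.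
  by rewrite sqrtr_sqr gtr0_norm.
move=> /cvg_ex[l /cvgrPdist_lt vl]; exists l => e e0.
have [|N _ vN] := vl (Num.sqrt e)%:C%C; first by rewrite (ltcR 0) sqrtr_gt0.
exists N => n Nn; rewrite /cinner inner_norm sqr_ltC//.
by rewrite distrC; exact: vN.
Qed.

HB.instance Definition _ := Lmodule_isHilbert.Build R (conjugate V)
  cinner_linearl cinnerC cinner_ge0 cinner_eq0 cinner_complete.

Lemma inner_conjugateE (x y : conjugate V) :
  inner x y = inner (y : V) (x : V).
Proof. by []. Qed.

Lemma rnorm_conjugate (x : V) : rnorm (x : conjugate V) = rnorm x.
Proof.
rewrite /rnorm; congr complex.Re.
apply/eqP; rewrite -(@eqrXn2 _ 2)// -!inner_norm; exact/eqP.
Qed.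

End conjugate_hilbert.



Section riesz.
Variables (R : realType) (V : hilbertType R).

Let riesz_linear (x : V) : linear ((inner^~ x) : V -> R[i]^o).
Proof. exact: inner_linearl. Qed.

Let riesz_bounded (x y : V) :
  rnorm (inner y x : R[i]^o) <= rnorm x * rnorm y.
Proof. by rewrite mulrC -lecR rmorphM/= -!rnormE cauchy_schwarz. Qed.

(* x |-> <., x>, which is linear as a map to the antidual. *)
Definition riesz (x : V) : conjugate (bop V R[i]^o) :=
  mk_bop (riesz_linear x) (riesz_bounded x).

Lemma riesz_is_linear : linear riesz.
Proof.
move=> a x y; apply/val_inj/funext => z /=.
by rewrite innerDr innerZr.
Qed.

HB.instance Definition _ :=
  GRing.isLinear.Build R[i] V (conjugate (bop V R[i]^o)) *:%R riesz riesz_is_linear.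

End riesz.

(* A family of norms on the spaces of square matrices over V. *)
Definition mxnorms (R : realType) (V : Type) := forall n, 'M[V]_n -> \bar R.

(* If T acts on the Hilbert space X with norm nX, the norm of A : 'M[T]_n as an
   operator on the n-fold Hilbertian direct sum of X, which is normed by
   h |-> sqrt (\sum_j nX (h j) ^+ 2). *)
Definition amplified_norm (R : realType) (T : Type) (X : zmodType)
    (nX : X -> R) (act : T -> X -> X) : mxnorms R T := fun n A =>
  ereal_sup [set (Num.sqrt (\sum_i nX (\sum_j act (A i j) (h j)) ^+ 2))%:E
            | h in [set h : 'I_n -> X | \sum_j nX (h j) ^+ 2 <= 1]].

(* M_n(B(H)) = B(H (+) ... (+) H) *)
Definition bop_mxnorms (R : realType) (H : hilbertType R) :
    mxnorms R (bop H H) :=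
  amplified_norm (@rnorm R H) (fun (T : bop H H) h => T h).

(* M_n(M_m), where M_m = B(C^m) acts on column vectors. *)
Definition matrix_mxnorms (R : realType) (m : nat) : mxnorms R 'M[R[i]]_m :=
  amplified_norm (fun v : 'cV[R[i]]_m => Num.sqrt (\sum_k abs2 (v k 0)))
                 (fun (A : 'M_m) v => A *m v).

Definition cb_norm (R : realType) (V W : Type) (nV : mxnorms R V)
    (nW : mxnorms R W) (u : V -> W) : \bar R :=
  ereal_sup [set y | exists n (x : 'M[V]_n),
                       (nV n x <= 1)%E /\ y = nW n (map_mx u x)].

Definition complete_isometry (R : realType) (V W : Type) (nV : mxnorms R V)
    (nW : mxnorms R W) (u : V -> W) : Prop :=
  forall n (x : 'M[V]_n), nW n (map_mx u x) = nV n x.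

(* An operator space structure on V. Since B(H) is complete, the closedness of
   the range makes V a Banach space. *)
Record opSpace (R : realType) (V : normedModType R[i]) := OpSpace {
  os_hilbert : hilbertType R ;
  os_emb : {linear V -> bop os_hilbert os_hilbert} ;
  os_isometric : forall x, `|os_emb x| = `|x| ;
  os_closed : closed (range os_emb)
}.

Definition os_mxnorms (R : realType) (V : normedModType R[i]) (S : opSpace V) :
    mxnorms R V :=
  fun n x => bop_mxnorms (map_mx (os_emb S) x).

(* M_m(V^* ) = cb(V, M_m): the matrix (f_ij) is the map x |-> (f_ij x). *)
Definition dual_mxnorms (R : realType) (V : normedModType R[i])
    (nV : mxnorms R V) : mxnorms R (bop V R[i]^o) :=
  fun m f => cb_norm nV (@matrix_mxnorms R m) (fun x => \matrix_(i, j) f i j x).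

(* For V in B(H), the space conjugate V sits in B(conjugate H) through the same
   maps (see conj_op), and conjugate H has the norm of H; hence the matrix norms
   of conjugate V are those of V. *)
Definition conjugate_mxnorms (R : realType) (V : Type) (nV : mxnorms R V) :
  mxnorms R (conjugate V) := nV.

(* S is a realization of OH(I). The norm of the Hilbert space V determines its
   inner product, so the isometry with ell2 R I is an isometry of Banach
   spaces. *)
Record is_OH (R : realType) (I : choiceType) (V : hilbertType R)
    (S : opSpace V) : Prop := IsOH {
  OH_isometric : exists U : {linear ell2 R I -> V},
    (forall x, `|U x| = `|x|) /\ range U = setT ;
  OH_selfdual : complete_isometry (os_mxnorms S)
    (conjugate_mxnorms (dual_mxnorms (os_mxnorms S))) (@riesz R V)
}.

Definition orthonormal_basis (R : realType) (V : hilbertType R)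
    (I : choiceType) (T : I -> V) : Prop :=
  (forall i j, inner (T i) (T j) = (i == j)%:R) /\
  closure [set x | exists (s : seq I) (c : I -> R[i]),
                     x = \sum_(i <- s) c i *: T i] = setT.

(* A realization of the Hilbertian tensor product of H and K: a Hilbert space in
   which the algebraic tensor product, with its canonical inner product, is
   dense. Realizations exist and are unique up to a unitary compatible with
   the bilinear map. *)
Record hilbertTensor (R : realType) (H K : hilbertType R) := HilbertTensor {
  ht_space :> hilbertType R ;
  ht_tens : {bilinear H -> K -> ht_space} ;
  ht_inner : forall h h' k k',
    inner (ht_tens h k) (ht_tens h' k') = inner h h' * inner k k' ;
  ht_dense : closure [set z | exists s : seq (H * K),
                 z = \sum_(p <- s) ht_tens p.1 p.2] = setT
}.

(* The operator S (x) T: the unique bounded operator mapping h (x) k to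
   S h (x) T k, so that the default value 0 is never used. *)
Definition tensor_op (R : realType) (H K : hilbertType R)
    (P : hilbertTensor H K) (S : bop H H) (T : bop K K) : bop P P :=
  xget 0 [set X : bop P P |
    forall h k, X (ht_tens P h k) = ht_tens P (S h) (T k)].

(* The norm in E (x)_min F of the finitely supported sum of the x i (x) y i. *)
Definition min_norm (R : realType) (E F : normedModType R[i])
    (SE : opSpace E) (SF : opSpace F)
    (P : hilbertTensor (os_hilbert SE) (os_hilbert SF))
    (I : choiceType) (x : I -> E) (y : I -> F) : R[i] :=
  `|\sum_(i \in [set: I]) tensor_op P (os_emb SE (x i)) (os_emb SF (y i))|.

Lemma closed_range_idfun (T : topologicalType) :
  closed (range (@idfun T)).
Proof. by rewrite image_id; exact: closedT. Qed.

Arguments min_norm {R E F} SE SF P {I} x y.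

Definition bop_opSpace (R : realType) (H : hilbertType R) :
    opSpace (bop H H) :=
  @OpSpace R (bop H H) H idfun (fun=> erefl) (@closed_range_idfun (bop H H)).

Section conj_op.
Variables (R : realType) (H : hilbertType R) (T : bop H H).

Let T' : conjugate H -> conjugate H := T.

Let T'_linear : linear T'.
Proof. by move=> a x y; exact: (proj1 (bopP T)). Qed.

Let T'_bounded x : rnorm (T' x) <= opnorm T * rnorm x.
Proof. by rewrite !rnorm_conjugate rnorm_bop. Qed.

(* T, seen as an element of B(conjugate H). *)
Definition conj_op : bop (conjugate H) (conjugate H) :=
  mk_bop T'_linear T'_bounded.

End conj_op.

(* Main.v *)
Require Import Defs.
From mathcomp Require Import all_boot all_order all_algebra.
From mathcomp Require Import all_classical all_reals.
From mathcomp Require Import topology normedtype complex.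
From mathcomp Require Import fsbigop ereal sequences esum.
From mathcomp Require Import sesquilinear spectral ring lra.

Set Implicit Arguments.
Unset Strict Implicit.
Unset Printing Implicit Defensive.
Import Order.TTheory GRing.Theory Num.Theory numFieldNormedType.Exports.
Local Open Scope classical_set_scope.
Local Open Scope ring_scope.

(** The proof is Pisier's. Let x be the matrix over OH with entries
    x_ij = sum_t <a_t e_j, e_i> T_t, the compression of sum_t T_t (x) a_t to the
    first n coordinates. Self-duality says that the norm of x is the supremum of
    the norms of the scalar matrices (<y_ij, x_kl>) over matrices y of norm at
    most 1. Taking for y a multiple of x gives
    ||(<x_ij, x_kl>)|| <= ||x||^2, and Haagerup's Cauchy-Schwarz inequality
    ||(<y_ij, x_kl>)||^2 <= ||(<y_ij, y_kl>)|| ||(<x_ij, x_kl>)|| gives the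
    converse. Since the T_t are orthonormal, (<x_ij, x_kl>) is the compression
    of sum_t a_t (x) conj a_t, and both sides are the suprema of their
    compressions. *)

(** * Positive matrices and balanced factorizations *)

Section positive_matrices.
Variable C : numClosedFieldType.
Local Open Scope sesquilinear_scope.

(** No norm is computed: each occurs only in a statement [norm <= M], rewritten as a bound on the
    squared modulus of a sesquilinear form, so an identity between norms becomes an equivalence
    between bounds. In the converse the unit matrix y is itself subject to the first inequality; its
    Gram matrix has norm at most 1, and Haagerup's inequality leaves only the Gram matrix of x. The
    second half is shaped by the completed tensor product: [tensor_op] is a chosen operator with no
    formula off the algebraic tensors. Its existence rests on Schur's product theorem and an
    extension by density, and norms are recovered from compressions through dense subspaces of
    finite sums. *)

Lemma adjmxM m n p (A : 'M[C]_(m, n)) (B : 'M[C]_(n, p)) :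
  (A *m B)^t* = B^t* *m A^t*.
Proof. by rewrite trmx_mul map_mxM. Qed.

Lemma adj_diag_mx n (d : 'rV[C]_n) :
  (forall j, 0 <= d 0 j) -> (diag_mx d)^t* = diag_mx d.
Proof.
move=> d0; rewrite tr_diag_mx map_diag_mx; congr diag_mx.
by apply/rowP => j; rewrite !mxE; exact: geC0_conj.
Qed.

Lemma psd_diagonalize n (A : 'M[C]_n) :
  A^t* = A ->
  (forall v : 'I_n -> C, 0 <= \sum_i \sum_j v i * A i j * (v j)^*) ->
  exists (P : 'M[C]_n) (d : 'rV[C]_n),
    [/\ P *m P^t* = 1%:M, P^t* *m P = 1%:M, forall j, 0 <= d 0 j &
        A = P^t* *m diag_mx d *m P].
Proof.
move=> AH Age0.
have Aherm : A \is hermsymmx.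
  by apply/is_hermitianmxP; rewrite expr0 scale1r AH.
pose P := spectralmx A; pose d := spectral_diag A.
have PU : P \is unitarymx by exact: spectral_unitarymx.
have PP : P *m P^t* = 1%:M by exact/unitarymxP.
have PP' : P^t* *m P = 1%:M.
  by rewrite -invmx_unitary// mulVmx// unitarymx_unit.
have AE : A = P^t* *m diag_mx d *m P.
  rewrite -invmx_unitary//; apply/orthomx_spectralP.
  exact: hermitian_normalmx.
exists P, d; split=> // r.
(* Each eigenvalue is a value of the form, namely at a row of [P]. *)
have -> : d 0 r = (P *m A *m P^t*) r r.
  rewrite AE !mulmxA PP mul1mx -mulmxA PP mulmx1.
  by rewrite !mxE eqxx mulr1n.
have := Age0 (P r); congr (_ <= _).
rewrite exchange_big mxE; apply: eq_bigr => j _.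
by rewrite !mxE mulr_suml.
Qed.

(** From A = P^* diag(d) P one takes D = P^* diag(sqrt d); this is how positivity enters Schur's
    product theorem. *)
Lemma psd_gram n (A : 'M[C]_n) :
  A^t* = A ->
  (forall v : 'I_n -> C, 0 <= \sum_i \sum_j v i * A i j * (v j)^*) ->
  exists D : 'M[C]_n, forall i j, A i j = \sum_r D i r * (D j r)^*.
Proof.
move=> AH Age0; have [P [d [_ _ d0 AE]]] := psd_diagonalize AH Age0.
exists (\matrix_(i, r) ((P r i)^* * sqrtC (d 0 r))) => i j.
rewrite AE mul_mx_diag mxE; apply: eq_bigr => r _.
have := @geC0_conj _ (sqrtC (d 0 r)); rewrite sqrtC_ge0 d0 => /(_ isT) sc.
rewrite !mxE rmorphM/= conjCK sc -{1}(sqrtCK (d 0 r)); ring.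
Qed.

Definition sqnorm_mx m n (h : 'M[C]_(m, n)) : C := \sum_i \sum_j `|h i j| ^+ 2.

Lemma sqnorm_mxE m n (h : 'M[C]_(m, n)) : sqnorm_mx h = \tr (h *m h^t*).
Proof.
rewrite /mxtrace; apply: eq_bigr => i _; rewrite mxE; apply: eq_bigr => j _.
by rewrite !mxE normCK.
Qed.

(** Cyclicity of the trace trades X X^*, whose Hilbert-Schmidt norm Haagerup's inequality asks for,
    for X^* X, which is diagonal for the balanced factors. *)
Lemma sqnorm_mx_gram m n (X : 'M[C]_(m, n)) :
  sqnorm_mx (X *m X^t*) = \tr ((X^t* *m X) *m (X^t* *m X)).
Proof.
by rewrite sqnorm_mxE adjmxM trmxCK mxtrace_mulC !mulmxA mxtrace_mulC !mulmxA.
Qed.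

Lemma sqnorm_mx_ge0 m n (h : 'M[C]_(m, n)) : 0 <= sqnorm_mx h.
Proof. by do 2 apply: sumr_ge0 => ? _; rewrite exprn_ge0. Qed.

Lemma adjmx_mul_diag_eq0 m n (X : 'M[C]_(m, n)) i r :
  (X^t* *m X) r r = 0 -> X i r = 0.
Proof.
rewrite mxE => /eqP.
under eq_bigr do rewrite !mxE mulrC -normCK.
rewrite psumr_eq0 => [/allP/(_ i (mem_index_enum _))|k _].
  by rewrite /= sqrf_eq0 normr_eq0 => /eqP.
exact: exprn_ge0.
Qed.

(* If h = U D V is a singular value decomposition, take h1 = U D^(1/2) and
   h2 = D^(1/2) V; here V and D^2 come from diagonalizing h^* h. *)
Lemma balanced_factorization m n (h : 'M[C]_(m, n)) :
  exists (h1 : 'M[C]_(m, n)) (h2 : 'M[C]_n),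
    [/\ h = h1 *m h2, sqnorm_mx (h1 *m h1^t*) = sqnorm_mx h &
        sqnorm_mx (h2^t* *m h2) = sqnorm_mx h].
Proof.
have GH : (h^t* *m h)^t* = h^t* *m h by rewrite adjmxM trmxCK.
have [|P [d [PP PP' d0 GE]]] := psd_diagonalize GH.
  (* The form of h^* h at [v] is the squared norm of [h] applied to the conjugate of [v]. *)
  move=> v; pose w i := \sum_j (v j)^* * h i j.
  rewrite [leRHS](_ : _ = \sum_k `|w k| ^+ 2).
    by apply: sumr_ge0 => k _; rewrite exprn_ge0.
  under [RHS]eq_bigr do rewrite normCK rmorph_sum/= big_distrlr/=.
  rewrite exchange_big [RHS]exchange_big; apply: eq_bigr => j _ /=.
  rewrite [RHS]exchange_big; apply: eq_bigr => i _ /=.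
  rewrite !mxE mulr_sumr mulr_suml; apply: eq_bigr => k _.
  rewrite !mxE rmorphM/= conjCK; ring.
(* [d] holds the squared singular values, so D^(1/2) is its fourth root. *)
have [s s0 s4] : exists2 s : 'rV[C]_n, forall j, 0 <= s 0 j &
    forall j, s 0 j ^+ 4 = d 0 j.
  exists (\row_j sqrtC (sqrtC (d 0 j))) => j; rewrite mxE ?sqrtC_ge0//.
  by rewrite (exprM _ 2 2) !sqrtCK.
(* This is D^(-1/2), with 0 as inverse of 0; that is harmless because the corresponding columns of h
   P^* vanish, by [hPn] below. *)
pose t : 'rV[C]_n := \row_j (s 0 j)^-1.
have t0 j : 0 <= t 0 j by rewrite mxE invr_ge0.
have sd j : (s 0 j == 0) = (d 0 j == 0) by rewrite -s4 expf_eq0.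
have trh : sqnorm_mx h = \sum_j d 0 j.
  rewrite sqnorm_mxE mxtrace_mulC GE mxtrace_mulC mulmxA PP mul1mx.
  exact: mxtrace_diag.
have hPd : P *m (h^t* *m h) *m P^t* = diag_mx d.
  by rewrite GE !mulmxA PP mul1mx -mulmxA PP mulmx1.
have hPn i r : d 0 r = 0 -> (h *m P^t*) i r = 0.
  move=> dr0; apply: adjmx_mul_diag_eq0.
  rewrite adjmxM trmxCK -mulmxA (mulmxA (h^t*)) mulmxA hPd.
  by rewrite !mxE eqxx dr0.
exists (h *m P^t* *m diag_mx t), (diag_mx s *m P).
have h1E : (h *m P^t* *m diag_mx t)^t* *m (h *m P^t* *m diag_mx t) =
    diag_mx (\row_j s 0 j ^+ 2).
  rewrite 2!adjmxM trmxCK adj_diag_mx// !mulmxA.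
  transitivity (diag_mx t *m (P *m (h^t* *m h) *m P^t*) *m diag_mx t).
    by rewrite !mulmxA.
  rewrite hPd !mulmx_diag; congr diag_mx.
  apply/rowP => j; rewrite !mxE -s4.
  have [->|x0] := eqVneq (s 0 j) 0; first by rewrite !expr0n invr0 !mulr0.
  by rewrite !exprS expr0 mulr1 mulKf// !mulrA mulfK.
have h2E : (diag_mx s *m P) *m (diag_mx s *m P)^t* =
    diag_mx (\row_j s 0 j ^+ 2).
  rewrite adjmxM adj_diag_mx// mulmxA -(mulmxA _ P) PP mulmx1.
  by rewrite mulmx_diag; congr diag_mx; apply/rowP => j; rewrite !mxE -expr2.
have trs : \tr (diag_mx (\row_j s 0 j ^+ 2) *m diag_mx (\row_j s 0 j ^+ 2)) =
    sqnorm_mx h.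
  rewrite mulmx_diag mxtrace_diag trh; apply: eq_bigr => j _.
  by rewrite !mxE -exprD s4.
split.
- rewrite mulmxA -(mulmxA _ (diag_mx t)) mulmx_diag.
  rewrite -[LHS]mulmx1 -PP' mulmxA; congr (_ *m _).
  apply/matrixP => i r; rewrite mul_mx_diag [RHS]mxE [X in _ = _ * X]mxE.
  have [dr0|dr0] := eqVneq (d 0 r) 0; first by rewrite hPn// mul0r.
  by rewrite [t 0 r]mxE mulVf ?sd// mulr1.
- by rewrite sqnorm_mx_gram h1E trs.
- by rewrite -{2}[diag_mx s *m P]trmxCK sqnorm_mx_gram trmxCK h2E trs.
Qed.

End positive_matrices.

(** * Haagerup's Cauchy-Schwarz inequality *)

Section dot_forms.
Variable R : realType.
Local Notation C := R[i].

(** A predicate on functions instead of a Hilbert structure, so that one set of lemmas serves inner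
    products, column vectors and finite families of either. *)
Definition dot_form (V : lmodType C) (f : V -> V -> C) : Prop :=
  [/\ forall z, linear_for *%R (f^~ z), forall x y, f y x = (f x y)^*,
      forall x, 0 <= f x x & forall x, f x x = 0 -> x = 0].

Section one_form.
Variables (V : lmodType C) (f : V -> V -> C).
Hypothesis ff : dot_form f.

Lemma dot_formDl x y z : f (x + y) z = f x z + f y z.
Proof. by case: ff => /(_ z 1 x y); rewrite scale1r mul1r. Qed.
Lemma dot_form0l z : f 0 z = 0.
Proof. by apply: (addrI (f 0 z)); rewrite -dot_formDl !addr0. Qed.
Lemma dot_formZl a x z : f (a *: x) z = a * f x z.
Proof. by case: ff => /(_ z a x 0); rewrite !addr0 dot_form0l addr0. Qed.
Lemma dot_formZr a x z : f z (a *: x) = a^* * f z x.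
Proof.
by case: (ff) => _ fC _ _; rewrite fC dot_formZl rmorphM/= -fC.
Qed.
Lemma dot_form_ge0 x : 0 <= f x x. Proof. by case: ff. Qed.

Lemma dot_form_CS x y : `|f x y| ^+ 2 <= f x x * f y y.
Proof.
case: ff => f1 f2 f3 f4; have := sesqui_cauchy_schwarz f1 f2 f3 f4 x y.
rewrite -(@ler_pXn2r _ 2)// ?nnegrE ?mulr_ge0 ?sqrtC_ge0//.
by rewrite exprMn !sqrtCK.
Qed.

(** [M] is the square of the norm bound, which avoids square roots. One direction is Cauchy-Schwarz
    after normalizing [x]; the other takes y = L x and cancels [f (L x) (L x)]. *)
Lemma dot_form_opnormP (L : V -> V) (M : C) : linear L -> 0 <= M ->
  (forall x, f x x <= 1 -> f (L x) (L x) <= M) <->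
  (forall x y, `|f (L x) y| ^+ 2 <= M * (f x x * f y y)).
Proof.
move=> Llin M0; split=> H x.
  move=> y; apply: le_trans (dot_form_CS _ _) _; rewrite mulrA.
  rewrite ler_wpM2r ?dot_form_ge0//.
  have L0 : L 0 = 0.
    by have := Llin (-1) 0 0; rewrite scaler0 addr0 scaleN1r addNr.
  have LZ a v : L (a *: v) = a *: L v.
    by have := Llin a v 0; rewrite L0 !addr0.
  have [x0|x0] := eqVneq (f x x) 0.
    have -> : x = 0 by case: (ff) => _ _ _; apply.
    by rewrite L0 !dot_form0l mulr0.
  have xp : 0 < f x x by rewrite lt_def x0 dot_form_ge0.
  have sp : 0 < (sqrtC (f x x))^-1 by rewrite invr_gt0 sqrtC_gt0.
  have s2 : (sqrtC (f x x))^-1 ^+ 2 = (f x x)^-1 by rewrite exprVn sqrtCK.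
  have := H ((sqrtC (f x x))^-1 *: x).
  rewrite LZ !dot_formZl !dot_formZr !(geC0_conj (ltW sp)) !mulrA -!expr2 s2.
  by rewrite mulVf// ![_^-1 * _]mulrC ler_pdivrMr//; apply.
move=> x1; have := H x (L x); rewrite ger0_norm ?dot_form_ge0//.
have [->//|Lx0] := eqVneq (f (L x) (L x)) 0.
have Lxp : 0 < f (L x) (L x) by rewrite lt_def Lx0 dot_form_ge0.
rewrite expr2 mulrA ler_pM2r// => /le_trans; apply.
by rewrite ler_piMr.
Qed.

Lemma dot_form_family (T : finType) :
  dot_form (fun x y : {ffun T -> V} => \sum_t f (x t) (y t)).
Proof.
case: (ff) => f1 f2 f3 f4; split.
- move=> z a x y; rewrite mulr_sumr -big_split; apply: eq_bigr => t _ /=.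
  by rewrite !ffunE; exact: f1.
- by move=> x y; rewrite rmorph_sum; apply: eq_bigr => t _ /=; exact: f2.
- by move=> x; apply: sumr_ge0 => t _.
- move=> x /eqP; rewrite psumr_eq0 => [/allP x0|//].
  apply/ffunP => t; rewrite ffunE; apply: f4; apply/eqP.
  exact: (x0 t (mem_index_enum _)).
Qed.

End one_form.

Lemma inner_dot_form (V : hilbertType R) : dot_form (@inner R V).
Proof.
split; [exact: inner_linearl|exact: innerC| |].
  by move=> x; rewrite inner_norm exprn_ge0.
by move=> x; rewrite inner_norm => /eqP; rewrite sqrf_eq0 normr_eq0 => /eqP.
Qed.

Lemma inner_suml (V : hilbertType R) (T : Type) (s : seq T) (P : pred T)
    (x : T -> V) z :
  inner (\sum_(t <- s | P t) x t) z = \sum_(t <- s | P t) inner (x t) z.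
Proof.
by apply: (big_morph (fun v => inner v z)) => [u v|]; rewrite ?innerDl ?inner0l.
Qed.

Lemma inner_sumr (V : hilbertType R) (T : Type) (s : seq T) (P : pred T)
    (x : T -> V) z :
  inner z (\sum_(t <- s | P t) x t) = \sum_(t <- s | P t) inner z (x t).
Proof.
rewrite innerC inner_suml rmorph_sum; apply: eq_bigr => t _ /=.
exact: esym (innerC _ _).
Qed.

Lemma inner_lincomb (V : hilbertType R) (T U : Type) (r : seq T) (s : seq U)
    (a : T -> C) (b : U -> C) (x : T -> V) (y : U -> V) :
  inner (\sum_(t <- r) a t *: x t) (\sum_(u <- s) b u *: y u) =
  \sum_(t <- r) \sum_(u <- s) a t * (b u)^* * inner (x t) (y u).
Proof.
rewrite inner_suml; apply: eq_bigr => t _; rewrite inner_sumr.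
by apply: eq_bigr => u _; rewrite innerZl innerZr mulrA.
Qed.

Section haagerup.
Variable V : hilbertType R.
Local Open Scope sesquilinear_scope.

(* The matrix (<y_ij, x_kl>) of M_m(M_n) acts on m x n matrices, and this is the
   sesquilinear form of that operator; p = (i, j) and q = (k, l). *)
Definition gram_form m n (y : 'M[V]_m) (x : 'M[V]_n) (h g : 'M[C]_(m, n)) : C :=
  \sum_(p : 'I_m * 'I_m) \sum_(q : 'I_n * 'I_n)
    inner (y p.1 p.2) (x q.1 q.2) * h p.2 q.2 * (g p.1 q.1)^*.

(** [M] bounds the square of the norm: norm at most N is [gram_bounded y x (N ^+ 2)]. *)
Definition gram_bounded m n (y : 'M[V]_m) (x : 'M[V]_n) (M : C) :=
  forall h g, `|gram_form y x h g| ^+ 2 <= M * (sqnorm_mx h * sqnorm_mx g).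

(* Haagerup's Cauchy-Schwarz inequality: balanced factorizations h = h1 h2 and
   g = g1 g2 turn the form into an inner product of families. *)
Lemma gram_bounded_CS m n (y : 'M[V]_m) (x : 'M[V]_n) (A B : C) :
  0 <= A -> 0 <= B -> gram_bounded y y (A ^+ 2) -> gram_bounded x x (B ^+ 2) ->
  gram_bounded y x (A * B).
Proof.
move=> A0 B0 yA xB h g.
have [h1 [h2 [hE hl hr]]] := balanced_factorization h.
have [g1 [g2 [gE gl gr]]] := balanced_factorization g.
(* [t] carries the two summation indices of h1 h2 and g1 g2. Factors attached to [y] go into [Y],
   those attached to [x] into [X], conjugated because the inner product is antilinear there. *)
pose Y := [ffun t : 'I_n * 'I_n =>
  \sum_(p : 'I_m * 'I_m) (h1 p.2 t.1 * (g1 p.1 t.2)^*) *: y p.1 p.2].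
pose X := [ffun t : 'I_n * 'I_n =>
  \sum_(q : 'I_n * 'I_n) ((h2 t.1 q.2)^* * g2 t.2 q.1) *: x q.1 q.2].
have YX : gram_form y x h g = \sum_t inner (Y t) (X t).
  symmetry; under [LHS]eq_bigr do rewrite !ffunE inner_lincomb.
  rewrite exchange_big; apply: eq_bigr => p _; rewrite exchange_big.
  apply: eq_bigr => q _; rewrite -mulr_suml [LHS]mulrC -[RHS]mulrA.
  congr (_ * _).
  rewrite hE gE !mxE rmorph_sum/= big_distrlr/= pair_big.
  by apply: eq_bigr => t _ /=; rewrite !rmorphM/= conjCK; ring.
have YY : \sum_t inner (Y t) (Y t) =
    gram_form y y (h1 *m h1^t*) (g1 *m g1^t*).
  under [LHS]eq_bigr do rewrite !ffunE inner_lincomb.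
  rewrite exchange_big; apply: eq_bigr => p _; rewrite exchange_big.
  apply: eq_bigr => q _; rewrite -mulr_suml [LHS]mulrC -[RHS]mulrA.
  congr (_ * _).
  rewrite !mxE rmorph_sum/= big_distrlr/= pair_big.
  by apply: eq_bigr => t _ /=; rewrite !mxE !rmorphM/= !conjCK; ring.
have XX : \sum_t inner (X t) (X t) =
    gram_form x x (h2^t* *m h2) (g2^t* *m g2).
  under [LHS]eq_bigr do rewrite !ffunE inner_lincomb.
  rewrite exchange_big; apply: eq_bigr => p _; rewrite exchange_big.
  apply: eq_bigr => q _; rewrite -mulr_suml [LHS]mulrC -[RHS]mulrA.
  congr (_ * _).
  rewrite !mxE rmorph_sum/= big_distrlr/= pair_big.
  by apply: eq_bigr => t _ /=; rewrite !mxE !rmorphM/= !conjCK; ring.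
have fam := dot_form_family (inner_dot_form V) ('I_n * 'I_n)%type.
have Y0 := dot_form_ge0 fam Y; have X0 := dot_form_ge0 fam X.
have S0 := mulr_ge0 (sqnorm_mx_ge0 h) (sqnorm_mx_ge0 g).
rewrite YX; apply: le_trans (dot_form_CS fam Y X) _.
(* The hypotheses bound the squares of both factors. By balance each bound involves the same product
   S of the norms of [h] and [g], so together they give (A B S)^2. *)
rewrite -(@ler_pXn2r _ 2)// ?nnegrE ?mulr_ge0 ?sqnorm_mx_ge0//.
have := ler_pM _ _ (yA (h1 *m h1^t*) (g1 *m g1^t*))
  (xB (h2^t* *m h2) (g2^t* *m g2)).
rewrite -YY -XX !exprn_ge0// ger0_norm// ger0_norm// hl gl hr gr.
move=> /(_ isT isT).
by rewrite -!exprMn mulrACA -exprMn -expr2 -exprMn.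
Qed.

End haagerup.
End dot_forms.

(** * Matrix norms as norms of sesquilinear forms *)

Section amplified.
Variable R : realType.
Local Notation C := R[i].

(** Serves both operators on a Hilbert space and scalar matrices on columns: [A] acts as one linear
    map [L] on the direct sum, to which [dot_form_opnormP] applies. *)
Lemma amplified_norm_leP (X : lmodType C) (f : X -> X -> C) (nX : X -> R)
    (T : Type) (act : T -> X -> X) n (A : 'M[T]_n) (M : R) :
  dot_form f -> (forall v, (nX v ^+ 2)%:C%C = f v v) ->
  (forall S, linear (act S)) -> 0 <= M ->
  (amplified_norm nX act A <= M%:E)%E <->
  (forall h g : {ffun 'I_n -> X},
     `|\sum_i f (\sum_j act (A i j) (h j)) (g i)| ^+ 2 <=
     (M ^+ 2)%:C%C * ((\sum_i f (h i) (h i)) * \sum_i f (g i) (g i))).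
Proof.
move=> ff nXE alin M0.
pose L (h : {ffun 'I_n -> X}) := [ffun i => \sum_j act (A i j) (h j)].
have Li h i : L h i = \sum_j act (A i j) (h j) by rewrite ffunE.
have Llin : linear L.
  move=> a x y; apply/ffunP => i; rewrite !ffunE scaler_sumr -big_split.
  by apply: eq_bigr => j _; rewrite !ffunE alin.
have M2 : 0 <= (M ^+ 2)%:C%C :> C by rewrite ler0c exprn_ge0.
have FE (h : 'I_n -> X) : (\sum_i nX (h i) ^+ 2)%:C%C = \sum_i f (h i) (h i).
  by rewrite rmorph_sum; apply: eq_bigr => i _; exact: nXE.
have LP := dot_form_opnormP (dot_form_family ff 'I_n) Llin M2.
apply: iff_trans (iff_trans LP _); last first.
  by split=> H h g; have := H h g;
    rewrite (eq_bigr _ (fun i _ => congr1 (f^~ (g i)) (Li h i))).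
have LE h : \sum_i f (L h i) (L h i) =
    (\sum_i nX (\sum_j act (A i j) (h j)) ^+ 2)%:C%C.
  by rewrite FE; apply: eq_bigr => i _; rewrite !ffunE.
split=> [H h h1|H].
  rewrite LE lecR -[leRHS](sqr_sqrtr (exprn_ge0 _ M0)).
  rewrite -[X in Num.sqrt X]/(M ^+ 2) sqrtr_sqr ger0_norm// -ler_sqrt ?exprn_ge0//.
  rewrite [leRHS]sqrtr_sqr ger0_norm//.
  rewrite -lee_fin; apply: le_trans H; apply: ereal_sup_ubound.
  by exists h => //=; rewrite -lecR FE.
apply: ge_ereal_sup => _ [h /= h1 <-]; rewrite lee_fin.
rewrite -[M]ger0_norm// -sqrtr_sqr ler_sqrt ?exprn_ge0//.
pose hf : {ffun 'I_n -> X} := [ffun j => h j].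
have hfE j : hf j = h j by rewrite ffunE.
have hfF : \sum_i f (hf i) (hf i) = (\sum_i nX (h i) ^+ 2)%:C%C.
  by rewrite FE; apply: eq_bigr => i _; rewrite hfE.
have := H hf; rewrite LE hfF (lecR _ 1) lecR => /(_ h1).
congr (_ <= _); apply: eq_bigr => i _; congr (nX _ ^+ 2).
by apply: eq_bigr => j _; rewrite hfE.
Qed.

Lemma bop_mxnorms_leP (H : hilbertType R) n (A : 'M[bop H H]_n) (M : R) :
  0 <= M ->
  (bop_mxnorms A <= M%:E)%E <->
  (forall h g : {ffun 'I_n -> H},
     `|\sum_i \sum_j inner (A i j (h j)) (g i)| ^+ 2 <=
     (M ^+ 2)%:C%C * ((\sum_i inner (h i) (h i)) * \sum_i inner (g i) (g i))).
Proof.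
move=> M0; apply: iff_trans (amplified_norm_leP A (inner_dot_form H) _ _ M0) _.
- by move=> v; rewrite rmorphXn/= -rnormE inner_norm.
- by move=> S; exact: (proj1 (bopP S)).
have E (h g : {ffun 'I_n -> H}) : \sum_i inner (\sum_j A i j (h j)) (g i) =
    \sum_i \sum_j inner (A i j (h j)) (g i).
  by apply: eq_bigr => i _; rewrite inner_suml.
by split=> HA h g; [rewrite -E|rewrite E].
Qed.

Let cdot n (u v : 'cV[C]_n) : C := \sum_k u k 0 * (v k 0)^*.

Let cdot_form n : dot_form (@cdot n).
Proof.
split.
- move=> z a x y; rewrite mulr_sumr -big_split; apply: eq_bigr => k _.
  by rewrite !mxE/= mulrDl mulrA.
- move=> x y; rewrite rmorph_sum; apply: eq_bigr => k _ /=.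
  by rewrite rmorphM/= conjCK mulrC.
- by move=> x; apply: sumr_ge0 => k _; rewrite -normCK exprn_ge0.
- move=> x /eqP; rewrite psumr_eq0 => [/allP x0|k _]; last first.
    by rewrite -normCK exprn_ge0.
  apply/colP => k; have := x0 k (mem_index_enum _); rewrite mxE /=.
  by rewrite -normCK sqrf_eq0 normr_eq0 => /eqP.
Qed.

Lemma abs2E (z : C) : (abs2 z)%:C%C = `|z| ^+ 2.
Proof.
rewrite normCK; case: z => a b; apply/eqP; rewrite eq_complex /abs2/=.
by apply/andP; split; apply/eqP; ring.
Qed.

Lemma gram_formE (V : hilbertType R) m n (y : 'M[V]_m) (x : 'M[V]_n)
    (h g : 'M[C]_(m, n)) :
  gram_form y x h g =
  \sum_i \sum_k \sum_j \sum_l inner (y i j) (x k l) * h j l * (g i k)^*.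
Proof.
rewrite /gram_form -(pair_bigA _ (fun i j => \sum_(q : 'I_n * 'I_n)
  inner (y i j) (x q.1 q.2) * h j q.2 * (g i q.1)^*))/=.
apply: eq_bigr => i _; rewrite [RHS]exchange_big.
by apply: eq_bigr => j _; rewrite pair_bigA.
Qed.

(** A family of m columns of height n is an m x n matrix with its Hilbert-Schmidt norm; under this
    reading the form of the operator is [gram_form]. *)
Lemma matrix_mxnorms_leP (V : hilbertType R) m n (y : 'M[V]_m) (x : 'M[V]_n)
    (M : R) : 0 <= M ->
  (@matrix_mxnorms R n m (\matrix_(i, j) \matrix_(k, l) inner (y i j) (x k l))
     <= M%:E)%E <->
  gram_bounded y x (M ^+ 2)%:C%C.
Proof.
move=> M0; apply: iff_trans (amplified_norm_leP _ (@cdot_form n) _ _ M0) _.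
- move=> v; rewrite sqr_sqrtr; last by apply: sumr_ge0 => k _; exact: abs2_ge0.
  by rewrite rmorph_sum; apply: eq_bigr => k _ /=; rewrite abs2E normCK.
- by move=> S a u v; rewrite mulmxDr scalemxAr.
have sqE (h : {ffun 'I_m -> 'cV[C]_n}) (h' : 'M[C]_(m, n)) :
    (forall i k, h' i k = h i k 0) -> \sum_i cdot (h i) (h i) = sqnorm_mx h'.
  move=> hh; apply: eq_bigr => i _; apply: eq_bigr => k _.
  by rewrite hh normCK.
have gE (h g : {ffun 'I_m -> 'cV[C]_n}) (h' g' : 'M[C]_(m, n)) :
    (forall i k, h' i k = h i k 0) -> (forall i k, g' i k = g i k 0) ->
    \sum_i cdot (\sum_j ((\matrix_(i, j) \matrix_(k, l) inner (y i j) (x k l))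
       i j : 'M_n) *m h j) (g i) = gram_form y x h' g'.
  move=> hh gg; rewrite gram_formE; apply: eq_bigr => i _.
  apply: eq_bigr => k _; rewrite summxE mulr_suml; apply: eq_bigr => j _.
  rewrite !mxE mulr_suml; apply: eq_bigr => l _.
  by rewrite !mxE hh gg.
split=> H h g.
  have e (u : 'M[C]_(m, n)) i k : u i k = [ffun i => \col_k u i k] i k 0.
    by rewrite ffunE mxE.
  by rewrite -(gE _ _ h g (e h) (e g)) -(sqE _ h (e h)) -(sqE _ g (e g)).
have e (u : {ffun 'I_m -> 'cV[C]_n}) i k :
  (\matrix_(i, k) u i k 0 : 'M_(m, n)) i k = u i k 0 by rewrite mxE.
by rewrite (gE h g _ _ (e h) (e g)) (sqE h _ (e h)) (sqE g _ (e g)).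
Qed.

End amplified.

(** * Consequences of self-duality *)

Section selfdual.
Variables (R : realType) (I : choiceType) (OH : hilbertType R) (S : opSpace OH).
Hypothesis hOH : is_OH I S.
Local Notation C := R[i].

Lemma OH_mxnorm_leP n (x : 'M[OH]_n) (M : R) : 0 <= M ->
  (os_mxnorms S x <= M%:E)%E <->
  (forall m (y : 'M[OH]_m), (os_mxnorms S y <= 1)%E ->
     gram_bounded y x (M ^+ 2)%:C%C).
Proof.
(* Passing to the image under [riesz] replaces the norm of [x] by a cb norm, that of v |-> (<v,
   x_kl>), which is by definition a supremum over [m] and [y]. *)
move=> M0; have <- : conjugate_mxnorms (dual_mxnorms (os_mxnorms S))
    (map_mx (@riesz R OH) x) = os_mxnorms S x by exact: (OH_selfdual hOH).
have rE m (y : 'M[OH]_m) : map_mx (fun v => \matrix_(i, j)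
      (map_mx (@riesz R OH) x : 'M[bop OH R[i]^o]_n) i j v : 'M[C]_n) y =
    \matrix_(i, j) \matrix_(k, l) inner (y i j) (x k l).
  by apply/matrixP => i j; apply/matrixP => k l; rewrite !mxE.
split=> [H m y y1|H].
  apply/matrix_mxnorms_leP => //; rewrite -rE; apply: le_trans H.
  by apply: ereal_sup_ubound; exists m, y.
apply: ge_ereal_sup => _ [m [y [y1 ->]]]; rewrite rE.
by apply/matrix_mxnorms_leP => //; exact: H.
Qed.

Lemma os_mxnorms_scale_le n (x : 'M[OH]_n) (a : R) (M : R) : 0 <= a -> 0 <= M ->
  (os_mxnorms S x <= M%:E)%E ->
  (os_mxnorms S (map_mx ( *:%R a%:C%C) x) <= (a * M)%:E)%E.
Proof.
move=> a0 M0 /(bop_mxnorms_leP _ M0) H; apply/bop_mxnorms_leP.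
  exact: mulr_ge0.
move=> h g; have := H h g.
have -> : \sum_i \sum_j inner
      (map_mx (os_emb S) (map_mx ( *:%R a%:C%C) x) i j (h j)) (g i) =
    a%:C%C * \sum_i \sum_j inner (map_mx (os_emb S) x i j (h j)) (g i).
  rewrite mulr_sumr; apply: eq_bigr => i _; rewrite mulr_sumr.
  by apply: eq_bigr => j _; rewrite !mxE linearZ/= -innerZl.
have -> : ((a * M) ^+ 2)%:C%C = a%:C%C ^+ 2 * (M ^+ 2)%:C%C :> C.
  by rewrite exprMn rmorphM rmorphXn.
move=> Hhg; rewrite normrM exprMn -[leRHS]mulrA ger0_norm ?ler0c//.
by rewrite ler_wpM2l// exprn_ge0// ler0c.
Qed.

(** The heart of the proof, the identity ||x||^2 = ||(<x_ij, x_kl>)||, in terms of bounds. [M] is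
    positive because the argument divides by its square root. *)
Lemma OH_mxnorm_gramP n (x : 'M[OH]_n) (M : R) : 0 < M ->
  (os_mxnorms S x <= (Num.sqrt M)%:E)%E <-> gram_bounded x x (M ^+ 2)%:C%C.
Proof.
have gram m (z : 'M[OH]_m) (N : R) : 0 < N ->
    (os_mxnorms S z <= (Num.sqrt N)%:E)%E -> gram_bounded z z (N ^+ 2)%:C%C.
  move=> N0 zN; have s0 : 0 < Num.sqrt N by rewrite sqrtr_gt0.
  (* The test matrix is z / sqrt N, of norm at most 1; multiplying the resulting bound sqrt N by
     sqrt N gives N. *)
  have := os_mxnorms_scale_le (a := (Num.sqrt N)^-1) _ _ zN.
  rewrite invr_ge0 sqrtr_ge0 mulVf ?gt_eqF// => /(_ isT isT) y1.
  have := proj1 (OH_mxnorm_leP z (sqrtr_ge0 N)) zN _ _ y1.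
  set y := map_mx _ _ => yb h g; have := yb h g.
  have -> : gram_form z z h g = (Num.sqrt N)%:C%C * gram_form y z h g.
    rewrite mulr_sumr; apply: eq_bigr => p _; rewrite mulr_sumr.
    apply: eq_bigr => q _; rewrite mxE innerZl !mulrA -rmorphM/=.
    by rewrite mulfV ?gt_eqF// mul1r.
  rewrite sqr_sqrtr ?(ltW N0)// => {}yb.
  rewrite normrM exprMn ger0_norm ?ler0c ?sqrtr_ge0//.
  have -> : (Num.sqrt N)%:C%C ^+ 2 = N%:C%C :> C.
    by rewrite -rmorphXn/= sqr_sqrtr ?(ltW N0).
  have -> : (N ^+ 2)%:C%C = N%:C%C * N%:C%C :> C by rewrite expr2 rmorphM.
  by rewrite -mulrA ler_wpM2l// ler0c ltW.
move=> M0; split; first exact: gram.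
move=> xM; apply/OH_mxnorm_leP => [|m y y1]; first exact: sqrtr_ge0.
(* The direction just proved, for [y] and N = 1; Cauchy-Schwarz then yields the constant 1 * M. *)
have y1' : gram_bounded y y (1 ^+ 2).
  have := gram _ y 1 ltr01; rewrite sqrtr1 => /(_ y1).
  by rewrite !expr1n.
rewrite sqr_sqrtr ?(ltW M0)// -[M%:C%C]mul1r.
apply: gram_bounded_CS => //; first by rewrite ler0c ltW.
by rewrite -rmorphXn.
Qed.

End selfdual.

(** * Dense subspaces *)

Section norm_closure.
Variables (R : realType) (V : normedModType R[i]).
Implicit Types (E : set V) (x y z : V).

Lemma rnormB x y : rnorm (x - y) = rnorm (y - x).
Proof. by rewrite /rnorm distrC. Qed.

Lemma closure_rnormP E z : closure E z <->
  forall e : R, 0 < e -> exists2 x, E x & rnorm (z - x) < e.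
Proof.
split=> [Ez e e0|H B].
  have [|x [Ex]] := Ez [set x | `|z - x| < e%:C%C].
    by apply/nbhs_normP; exists e%:C%C => //=; rewrite (ltcR 0).
  by rewrite /= rnormE ltcR; exists x.
move=> /nbhs_normP[e /= e0 eB].
have eE : e = (complex.Re e)%:C%C by rewrite RRe_real// gtr0_real.
have [|x Ex zx] := H (complex.Re e); first by rewrite -ltcR -eE.
by exists x; split=> //; apply: eB => /=; rewrite eE rnormE ltcR.
Qed.

Definition linear_subspace E :=
  E 0 /\ forall (a : R[i]) x y, E x -> E y -> E (a *: x + y).

Definition closed_subspace E := linear_subspace E /\
  forall z, (forall e : R, 0 < e -> exists2 x, E x & rnorm (z - x) < e) -> E z.

(** Totality as an induction principle: a property defining a closed subspace holds everywhere once
    it holds on [E]. *)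
Definition total_set E :=
  forall F, closed_subspace F -> (forall x, E x -> F x) -> forall z, F z.

Lemma rabs_ge0 (a : R[i]) : 0 <= complex.Re `|a|.
Proof. by rewrite -ler0c RRe_real ?normr_real. Qed.

Lemma closure_closed_subspace E : linear_subspace E ->
  closed_subspace
    [set z | forall e : R, 0 < e -> exists2 x, E x & rnorm (z - x) < e].
Proof.
move=> [E0 EL]; split; first split.
- by move=> e e0; exists 0 => //; rewrite subrr rnorm0.
- move=> a x y /= Ex Ey e e0.
  (* The 1 keeps the divisor positive when a = 0. *)
  pose c := complex.Re `|a| + 1.
  have c0 : 0 < c by rewrite ltr_wpDl ?rabs_ge0.
  have [|x' Ex' xx'] := Ex (e / 2 / c); first by rewrite !divr_gt0.
  have [|y' Ey' yy'] := Ey (e / 2); first by rewrite divr_gt0.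
  exists (a *: x' + y'); first exact: EL.
  rewrite opprD addrACA -scalerBr; apply: le_lt_trans (ler_rnormD _ _) _.
  rewrite [ltRHS](splitr e) ler_ltD// rnormZ.
  have := ltW xx'; rewrite ler_pdivlMr// => /(le_trans _); apply.
  by rewrite mulrC ler_wpM2l ?rnorm_ge0// lerDl.
- move=> z /= zE e e0; have [|x xE zx] := zE (e / 2); first by rewrite divr_gt0.
  have [|y Ey xy] := xE (e / 2); first by rewrite divr_gt0.
  exists y => //; rewrite -(subrKA x); apply: le_lt_trans (ler_rnormD _ _) _.
  by rewrite [ltRHS](splitr e) ltrD.
Qed.

(** Goes back from induction to approximation: the closure of [F] is a closed subspace containing
    [E]. *)
Lemma total_dense E F z : total_set E -> linear_subspace F ->
  (forall x, E x -> F x) ->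
  forall e : R, 0 < e -> exists2 x, F x & rnorm (z - x) < e.
Proof.
move=> Et Fl EF; apply: (Et _ (closure_closed_subspace Fl)) => x Ex e e0.
by exists x; [exact: EF|rewrite subrr rnorm0].
Qed.

End norm_closure.

Lemma ler_addeps_mul (R : realType) (a b c : R) : 0 <= c ->
  (forall e, 0 < e -> a <= b + c * e) -> a <= b.
Proof.
move=> c0 H; apply/ler_addgt0Pr => e e0.
have c1 : 0 < c + 1 by rewrite ltr_wpDl.
apply: le_trans (H (e / (c + 1)) _) _; first by rewrite divr_gt0.
rewrite lerD2l mulrCA ler_piMr ?ltW//.
by rewrite ltr_pdivrMr// mul1r ltrDl.
Qed.

Section dense_extension.
Variables (R : realType) (V : normedModType R[i]).
Variable W : completeNormedModType R[i].
(** [G] is the graph of a bounded, densely defined operator. Being a relation, it can be prescribed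
    through representations of vectors, before anything is known to be well defined. *)
Variables (G : V -> W -> Prop) (M : R).
Hypothesis GL : forall (a : R[i]) x y x' y', G x y -> G x' y' ->
  G (a *: x + x') (a *: y + y').
Hypothesis M0 : 0 <= M.
Hypothesis GM : forall x y, G x y -> rnorm y <= M * rnorm x.
Hypothesis Gd : forall z (e : R), 0 < e ->
  exists2 x, (exists y, G x y) & rnorm (z - x) < e.

Let GB x y x' y' : G x y -> G x' y' -> G (x - x') (y - y').
Proof.
move=> xy xy'; have := GL (-1) xy' xy.
by rewrite !scaleN1r addrC [- y' + _]addrC.
Qed.

Let G' z w := forall e : R, 0 < e ->
  exists x y, [/\ G x y, rnorm (z - x) < e & rnorm (w - y) < e].

Let GG' x y : G x y -> G' x y.
Proof. by move=> xy e e0; exists x, y; rewrite !subrr !rnorm0. Qed.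

Let G'L (a : R[i]) x y x' y' : G' x y -> G' x' y' ->
  G' (a *: x + x') (a *: y + y').
Proof.
move=> xy xy' e e0.
pose c := complex.Re `|a| + 1.
have c0 : 0 < c by rewrite ltr_wpDl ?rabs_ge0.
have [|u [v [uv xu yv]]] := xy (e / 2 / c); first by rewrite !divr_gt0.
have [|u' [v' [uv' xu' yv']]] := xy' (e / 2); first by rewrite divr_gt0.
have aux (U : normedModType R[i]) (x1 u1 x2 u2 : U) :
    rnorm (x1 - u1) < e / 2 / c -> rnorm (x2 - u2) < e / 2 ->
    rnorm (a *: x1 + x2 - (a *: u1 + u2)) < e.
  move=> d1 d2; rewrite opprD addrACA -scalerBr.
  apply: le_lt_trans (ler_rnormD _ _) _.
  rewrite [ltRHS](splitr e) ler_ltD// rnormZ.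
  have := ltW d1; rewrite ler_pdivlMr// => /(le_trans _); apply.
  by rewrite mulrC ler_wpM2l ?rnorm_ge0// lerDl.
exists (a *: u + u'), (a *: v + v'); split; [exact: GL|exact: aux|exact: aux].
Qed.

Let G'M z w : G' z w -> rnorm w <= M * rnorm z.
Proof.
move=> zw; apply: (@ler_addeps_mul _ _ _ (1 + M)); first by rewrite addr_ge0.
move=> e /zw[x [y [xy zx wy]]].
have -> : w = (w - y) + y by rewrite subrK.
apply: le_trans (ler_rnormD _ _) _.
rewrite mulrDl mul1r addrCA lerD ?(ltW wy)// -mulrDr.
apply: le_trans (GM xy) _; rewrite ler_wpM2l//.
have -> : x = z + (x - z) by rewrite addrC subrK.
by apply: le_trans (ler_rnormD _ _) _; rewrite lerD2l rnormB ltW.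
Qed.

Let small (e : R) : 0 < e -> exists N, forall n, (N <= n)%N -> n.+1%:R^-1 < e.
Proof.
move=> e0; have [N] := ltr_add_invr e0; rewrite add0r => Ne.
exists N => n Nn; apply: le_lt_trans Ne.
by rewrite lef_pV2 ?posrE ?ltr0n// ler_nat.
Qed.

Let G'ex z : exists w, G' z w.
Proof.
(* Approximants within 1/(n+1) of [z]; the bound on [G] makes their images a Cauchy sequence. *)
have /choice[f fG] (n : nat) : exists p : V * W,
    G p.1 p.2 /\ rnorm (z - p.1) < n.+1%:R^-1.
  by have [|x [y xy] zx] := @Gd z n.+1%:R^-1; [rewrite invr_gt0|exists (x, y)].
have fM m n : rnorm ((f m).2 - (f n).2) <= M * (m.+1%:R^-1 + n.+1%:R^-1).
  have [[Gm zm] [Gn zn]] := (fG m, fG n).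
  apply: le_trans (GM (GB Gm Gn)) _; rewrite ler_wpM2l// -(subrKA z).
  by apply: le_trans (ler_rnormD _ _) _; rewrite lerD ?(ltW zn)// rnormB ltW.
have cR (e : R[i]) : 0 < e -> e = (complex.Re e)%:C%C.
  by move=> e0; rewrite RRe_real ?gtr0_real.
have M1 : 0 < M + 1 by rewrite ltr_wpDl.
have : cvg ((f n).2 @[n --> \oo]).
  apply/cauchy_cvgP/cauchyP => e e0.
  have r0 : 0 < complex.Re e by rewrite -ltcR -cR.
  have [|N Ne] := small (e := complex.Re e / 2 / (M + 1)).
    by rewrite !divr_gt0.
  exists (f N).2; exists N => // n /= Nn; rewrite -ball_normE/= (cR e e0).
  rewrite rnormE ltcR; apply: le_lt_trans (fM N n) _.
  apply: (@le_lt_trans _ _ ((M + 1) * (N.+1%:R^-1 + n.+1%:R^-1))).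
    by rewrite ler_wpM2r ?addr_ge0 ?invr_ge0// lerDl.
  rewrite mulrC -ltr_pdivlMr// (splitr (complex.Re e)) mulrDl.
  by rewrite ltrD// Ne.
move=> /cvg_ex[w /cvgrPdist_lt fw]; exists w => e e0.
have [|N _ wN] := fw e%:C%C; first by rewrite (ltcR 0).
have [N' N'e] := small e0.
have [Gm zm] := fG (maxn N N').
exists (f (maxn N N')).1, (f (maxn N N')).2; split=> //.
  by apply: lt_trans zm _; apply: N'e; exact: leq_maxr.
by rewrite -ltcR -rnormE; apply: wN => /=; exact: leq_maxl.
Qed.

(** The closure [G'] of the graph inherits linearity and the bound; the bound makes it
    single-valued, and completeness of [W] makes it everywhere defined. *)
Lemma dense_extension : exists X : bop V W, forall x y, G x y -> X x = y.
Proof.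
have /choice[X XG] := G'ex.
have uniq z w w' : G' z w -> G' z w' -> w = w'.
  move=> zw zw'; apply/eqP; rewrite -subr_eq0; apply/eqP; apply: rnorm0_eq0.
  have := G'M (G'L (-1) zw' zw); rewrite !scaleN1r addNr rnorm0 mulr0 addrC.
  by move=> ww'; apply/eqP; rewrite eq_le rnorm_ge0 andbT.
have Xlin : linear X.
  by move=> a x y; apply: uniq (XG _) _; exact: G'L.
exists (mk_bop Xlin (fun x => G'M (XG x))) => x y xy.
by apply: uniq (XG x) _; exact: GG'.
Qed.

End dense_extension.

(** * Operators on Hilbertian tensor products *)

Section tensors.
Variable R : realType.
Local Notation C := R[i].

Lemma inner_rnorm (V : hilbertType R) (x : V) :
  inner x x = (rnorm x ^+ 2)%:C%C.
Proof. by rewrite inner_norm rnormE rmorphXn. Qed.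

Section schur.
Local Open Scope sesquilinear_scope.

(* Schur's product theorem, one of the two matrices being a Gram matrix. *)
Lemma psd_gram_sum_ge0 (W : hilbertType R) n (A : 'M[C]_n) (k : 'I_n -> W) :
  A^t* = A ->
  (forall v : 'I_n -> C, 0 <= \sum_i \sum_j v i * A i j * (v j)^*) ->
  0 <= \sum_i \sum_j A i j * inner (k i) (k j).
Proof.
move=> AH /(psd_gram AH)[D AD].
rewrite (_ : \sum_i _ =
    \sum_r inner (\sum_i D i r *: k i) (\sum_i D i r *: k i)).
  by apply: sumr_ge0 => r _; exact: dot_form_ge0 (inner_dot_form W) _.
under [RHS]eq_bigr do rewrite inner_lincomb.
rewrite [RHS]exchange_big; apply: eq_bigr => i _; rewrite [RHS]exchange_big.
by apply: eq_bigr => j _; rewrite AD mulr_suml.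
Qed.

(** This is the boundedness of S (x) 1, written without the tensor product. The matrix c <h_i, h_j>
    - <S h_i, S h_j> is positive, its form at [v] being c |z|^2 - |S z|^2 with z the combination of
    the h_i; Schur's theorem applies to it and the Gram matrix of [k]. *)
Lemma gram_sum_bop_le (V W : hilbertType R) (S : bop V V) n
    (h : 'I_n -> V) (k : 'I_n -> W) :
  \sum_i \sum_j inner (S (h i)) (S (h j)) * inner (k i) (k j) <=
  (opnorm S ^+ 2)%:C%C * \sum_i \sum_j inner (h i) (h j) * inner (k i) (k j).
Proof.
set c := (_ ^+ 2)%:C%C.
have cc : c^* = c by rewrite geC0_conj// ler0c exprn_ge0 ?opnorm_ge0.
pose A : 'M[C]_n :=
  \matrix_(i, j) (c * inner (h i) (h j) - inner (S (h i)) (S (h j))).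
have AH : A^t* = A.
  apply/matrixP => i j; rewrite !mxE; rewrite [LHS]rmorphB/= rmorphM/=.
  by rewrite -!innerC; congr (_ * _ - _).
have := psd_gram_sum_ge0 k AH.
rewrite (_ : (\sum_i \sum_j A i j * _) =
  c * (\sum_i \sum_j inner (h i) (h j) * inner (k i) (k j)) -
  \sum_i \sum_j inner (S (h i)) (S (h j)) * inner (k i) (k j)); last first.
  rewrite mulr_sumr -sumrB; apply: eq_bigr => i _.
  rewrite mulr_sumr -sumrB; apply: eq_bigr => j _.
  by rewrite mxE mulrBl mulrA.
rewrite subr_ge0; apply=> v; pose z := \sum_i v i *: h i.
rewrite (_ : \sum_i _ = c * inner z z - inner (S z) (S z)); last first.
  have -> : S z = \sum_i v i *: S (h i).
    by rewrite linear_sum; apply: eq_bigr => i _; rewrite linearZ.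
  rewrite !inner_lincomb mulr_sumr -sumrB; apply: eq_bigr => i _.
  rewrite mulr_sumr -sumrB; apply: eq_bigr => j _.
  by rewrite mxE; ring.
rewrite subr_ge0 !inner_rnorm -rmorphM lecR -exprMn.
by rewrite lerXn2r ?nnegrE ?mulr_ge0 ?opnorm_ge0 ?rnorm_ge0// rnorm_bop.
Qed.

End schur.

Section tensor_operators.
Variables (H K : hilbertType R) (P : hilbertTensor H K).
Local Notation "h ⊗ k" := (ht_tens P h k) (at level 35).

Let spanned (z : P) := exists s : seq (H * K), z = \sum_(p <- s) p.1 ⊗ p.2.

Lemma elementary_tensors_total : total_set [set z | exists h k, z = h ⊗ k].
Proof.
move=> F [[F0 FL] Fc] FT z; apply: Fc.
have /closure_rnormP dense : closure spanned z by rewrite ht_dense.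
move=> e /dense[x [s ->] zx]; exists (\sum_(p <- s) p.1 ⊗ p.2) => //.
elim: s {zx} => [|p s IH]; first by rewrite big_nil.
rewrite big_cons -[_ ⊗ _]scale1r; apply: FL => //.
by apply: FT; exists p.1, p.2.
Qed.

Lemma rnorm_tens h k : rnorm (h ⊗ k) = rnorm h * rnorm k.
Proof.
apply/eqP; rewrite -(@eqrXn2 _ 2)// ?mulr_ge0 ?rnorm_ge0//.
apply/eqP; apply: complexI.
by rewrite -inner_rnorm ht_inner !inner_rnorm -rmorphM exprMn.
Qed.

(** For a closed subspace [F], the vectors h with h ⊗ k in [F] form a closed subspace, and likewise
    for k; totality is used in one factor at a time. *)
Lemma tensor_total (A : set H) (B : set K) : total_set A -> total_set B ->
  total_set [set z | exists h k, [/\ A h, B k & z = h ⊗ k]].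
Proof.
move=> At Bt F [[F0 FL] Fc] FT; apply: elementary_tensors_total => //.
have closed1 k : closed_subspace [set h | F (h ⊗ k)].
  split; first split; rewrite /=.
  - by rewrite linear0l.
  - by move=> a x y Fx Fy; rewrite linearPl; exact: FL.
  - move=> h hF; apply: Fc => e e0; have c0 : 0 < rnorm k + 1.
      by rewrite ltr_wpDl ?rnorm_ge0.
    have [|x Fx hx] := hF (e / (rnorm k + 1)); first by rewrite divr_gt0.
    exists (x ⊗ k) => //; rewrite -linearBl rnorm_tens.
    apply: le_lt_trans (_ : rnorm (h - x) * (rnorm k + 1) < e).
      by rewrite ler_wpM2l ?rnorm_ge0// lerDl.
    by rewrite -ltr_pdivlMr.
have closed2 h : closed_subspace [set k | F (h ⊗ k)].
  split; first split; rewrite /=.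
  - by rewrite linear0r.
  - by move=> a x y Fx Fy; rewrite linearPr; exact: FL.
  - move=> k kF; apply: Fc => e e0; have c0 : 0 < rnorm h + 1.
      by rewrite ltr_wpDl ?rnorm_ge0.
    have [|x Fx kx] := kF (e / (rnorm h + 1)); first by rewrite divr_gt0.
    exists (h ⊗ x) => //; rewrite -linearBr rnorm_tens mulrC.
    apply: le_lt_trans (_ : rnorm (k - x) * (rnorm h + 1) < e).
      by rewrite ler_wpM2l ?rnorm_ge0// lerDl.
    by rewrite -ltr_pdivlMr.
move=> _ [h [k ->]]; apply: (At _ (closed1 k)) => h' Ah'.
apply: (Bt _ (closed2 h')) => k' Bk'.
by apply: FT; exists h', k'.
Qed.

Lemma inner_sum_tens n (h h' : 'I_n -> H) (k k' : 'I_n -> K) :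
  inner (\sum_i h i ⊗ k i) (\sum_i h' i ⊗ k' i) =
  \sum_i \sum_j inner (h i) (h' j) * inner (k i) (k' j).
Proof.
rewrite inner_suml; apply: eq_bigr => i _; rewrite inner_sumr.
by apply: eq_bigr => j _; rewrite ht_inner.
Qed.

(** S (x) T is (S (x) 1)(1 (x) T), so the one-sided estimate is used twice, with the factors swapped
    the second time. *)
Lemma rnorm_sum_tens_le (S : bop H H) (T : bop K K) n
    (h : 'I_n -> H) (k : 'I_n -> K) :
  rnorm (\sum_i S (h i) ⊗ T (k i)) <=
  opnorm S * opnorm T * rnorm (\sum_i h i ⊗ k i).
Proof.
rewrite -(@ler_pXn2r _ 2)// ?nnegrE ?mulr_ge0 ?opnorm_ge0 ?rnorm_ge0//.
rewrite -lecR -inner_rnorm inner_sum_tens.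
apply: le_trans (gram_sum_bop_le S h (fun i => T (k i))) _.
rewrite 2!exprMn -mulrA [leRHS]rmorphM.
apply: ler_wpM2l; first by rewrite ler0c exprn_ge0 ?opnorm_ge0.
under eq_bigr do under eq_bigr do rewrite mulrC.
apply: le_trans (gram_sum_bop_le T k h) _.
rewrite [leRHS]rmorphM; apply: ler_wpM2l.
  by rewrite ler0c exprn_ge0 ?opnorm_ge0.
rewrite -[leRHS]inner_rnorm inner_sum_tens.
by under eq_bigr do under eq_bigr do rewrite mulrC.
Qed.

Lemma tensor_op_ex (S : bop H H) (T : bop K K) :
  exists X : bop P P, forall h k, X (h ⊗ k) = S h ⊗ T k.
Proof.
(* The image [w] depends a priori on the representation [s] of [z]; [rnorm_sum_tens_le] is the bound
   that removes this dependence. *)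
pose G (z w : P) := exists s : seq (H * K),
  z = \sum_(p <- s) p.1 ⊗ p.2 /\ w = \sum_(p <- s) S p.1 ⊗ T p.2.
have [||||X XG] := @dense_extension R P P G (opnorm S * opnorm T).
- move=> a x y x' y' [s [-> ->]] [t [-> ->]].
  exists ([seq (a *: p.1, p.2) | p <- s] ++ t).
  rewrite !big_cat !big_map !scaler_sumr; split; congr (_ + _);
    by apply: eq_bigr => p _; rewrite ?linearZ/= ?linearZl_LR.
- by rewrite mulr_ge0 ?opnorm_ge0.
- move=> _ _ [s [-> ->]].
  rewrite [in leLHS]big_tnth [in leRHS]big_tnth; exact: rnorm_sum_tens_le.
- move=> z e e0.
  have /closure_rnormP dense : closure spanned z by rewrite ht_dense.
  have [x [s xs] zx] := dense e e0; exists x => //.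
  by exists (\sum_(p <- s) S p.1 ⊗ T p.2), s.
exists X => h k; apply: XG.
by exists [:: (h, k)]; rewrite !big_seq1.
Qed.

Lemma tensor_opE (S : bop H H) (T : bop K K) h k :
  tensor_op P S T (h ⊗ k) = S h ⊗ T k.
Proof.
have [X XE] := tensor_op_ex S T.
exact: (@xgetPex _ 0 [set X : bop P P | forall h k, X (h ⊗ k) = S h ⊗ T k]
  (ex_intro _ X XE)).
Qed.

Lemma bop_total_eq0 (X : bop P P) : (forall h k, X (h ⊗ k) = 0) -> X = 0.
Proof.
move=> X0; apply/val_inj/funext => z /=.
have := @elementary_tensors_total [set z | X z = 0] _ _ z; apply.
  split; first split; rewrite /=.
  - exact: linear0.
  - by move=> a x y x0 y0; rewrite (proj1 (bopP X)) x0 y0 scaler0 addr0.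
  - move=> x xX; apply: rnorm0_eq0; apply/eqP; rewrite eq_le rnorm_ge0 andbT.
    apply: (@ler_addeps_mul _ _ _ (opnorm X)); first exact: opnorm_ge0.
    move=> e /xX[y y0 xy]; rewrite add0r -[X x]subr0 -y0 -linearB.
    by apply: le_trans (rnorm_bop _ _) _; rewrite ler_wpM2l ?opnorm_ge0 ?ltW.
by move=> _ [h [k ->]].
Qed.

Lemma tensor_op0 (S : bop H H) : tensor_op P S 0 = 0.
Proof.
by apply: bop_total_eq0 => h k; rewrite tensor_opE linear0r.
Qed.

End tensor_operators.

(** X x need not lie in [D], so for x in [D] it is tested against nearby elements of [D]; a second
    approximation then moves x to arbitrary vectors. *)
Lemma dense_opnorm_leP (V : hilbertType R) (D : set V) (X : bop V V) (M : R) :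
  (forall z (e : R), 0 < e -> exists2 x, D x & rnorm (z - x) < e) -> 0 <= M ->
  (opnorm X <= M) <->
  (forall x y, D x -> D y ->
     `|inner (X x) y| ^+ 2 <= (M ^+ 2)%:C%C * (inner x x * inner y y)).
Proof.
move=> Dd M0; split=> [XM x y _ _|H].
  apply: le_trans (dot_form_CS (inner_dot_form V) _ _) _.
  rewrite mulrA ler_wpM2r ?dot_form_ge0//; first exact: inner_dot_form.
  rewrite !inner_rnorm -rmorphM lecR -exprMn.
  rewrite lerXn2r ?nnegrE ?mulr_ge0 ?rnorm_ge0//.
  by apply: le_trans (rnorm_bop _ _) _; rewrite ler_wpM2r ?rnorm_ge0.
have Hr x y : D x -> D y -> `|inner (X x) y| <= (M * (rnorm x * rnorm y))%:C%C.
  have c0 : 0 <= M * (rnorm x * rnorm y) by rewrite !mulr_ge0 ?rnorm_ge0.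
  move=> Dx Dy; rewrite -(@ler_pXn2r _ 2)// ?nnegrE//; last by rewrite ler0c.
  apply: le_trans (H x y Dx Dy) _.
  by rewrite !inner_rnorm -!rmorphM -rmorphXn/= !exprMn.
have XD x : D x -> rnorm (X x) <= M * rnorm x.
  move=> Dx; have [->|Xx0] := eqVneq (rnorm (X x)) 0.
    by rewrite mulr_ge0 ?rnorm_ge0.
  have Xxp : 0 < rnorm (X x) by rewrite lt_def Xx0 rnorm_ge0.
  (* Multiplied by |X x|, the left side becomes <X x, X x>, whose second argument can be
     approximated from [D]. *)
  rewrite -(ler_pM2r Xxp) -expr2.
  apply: (@ler_addeps_mul _ _ _ (rnorm (X x) + M * rnorm x)).
    by rewrite addr_ge0 ?mulr_ge0 ?rnorm_ge0.
  move=> e e0; have [y Dy Xy] := Dd (X x) e e0.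
  rewrite -lecR -inner_rnorm -[leLHS]ger0_norm; last first.
    exact: dot_form_ge0 (inner_dot_form V) _.
  rewrite -{2}[X x](subrK y) innerDr; apply: le_trans (ler_normD _ _) _.
  apply: (@le_trans _ _ ((rnorm (X x) * e)%:C%C +
      (M * (rnorm x * (rnorm (X x) + e)))%:C%C)); last first.
    by rewrite -rmorphD lecR; lra.
  apply: lerD.
    apply: le_trans (cauchy_schwarz _ _) _; rewrite !rnormE -rmorphM lecR.
    by rewrite ler_wpM2l ?rnorm_ge0// ltW.
  apply: le_trans (Hr x y Dx Dy) _; rewrite lecR !ler_wpM2l ?rnorm_ge0//.
  rewrite -[y](subKr (X x)) (le_trans (ler_rnormD _ _))// lerD2l.
  by rewrite -scaleN1r rnormZ normrN1 mul1r ltW.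
apply: opnorm_le => // z.
apply: (@ler_addeps_mul _ _ _ (opnorm X + M)).
  by rewrite addr_ge0 ?opnorm_ge0.
move=> e e0; have [x Dx zx] := Dd z e e0.
rewrite -{1}[z](subrK x) linearD; apply: le_trans (ler_rnormD _ _) _.
have h1 : rnorm (X (z - x)) <= opnorm X * e.
  by apply: le_trans (rnorm_bop _ _) _; rewrite ler_wpM2l ?opnorm_ge0 ?ltW.
have h2 : rnorm (X x) <= M * (rnorm z + e).
  apply: le_trans (XD x Dx) _; rewrite ler_wpM2l//.
  rewrite -[x](subrK z) addrC (le_trans (ler_rnormD _ _))// lerD2l.
  by rewrite rnormB ltW.
by rewrite mulrDl mulrDr in h2 *; lra.
Qed.

End tensors.

(** * The canonical basis of l2 *)

Section ell2_basis.
Variable R : realType.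
Local Notation C := R[i].

Section one_index_set.
Variable I : choiceType.

Lemma nnsum_single (f : I -> R) i : (forall j, 0 <= f j) ->
  (forall j, j != i -> f j = 0) -> nnsum f = (f i)%:E.
Proof.
move=> f0 fi; rewrite -(@esum_set1 R I i (fun j => (f j)%:E)) ?lee_fin//.
rewrite esum_mkcond; apply: eq_esum => j _; case: ifPn => // jNi.
by rewrite fi//; apply: contraNneq jNi => ->; rewrite inE.
Qed.

Lemma rsum_single (f : I -> R) i : (forall j, j != i -> f j = 0) ->
  rsum f = f i.
Proof.
move=> fi; rewrite /rsum !(@nnsum_single _ i)/=.
- by case: (leP (f i) 0) => ?; case: (leP (- f i) 0) => ?; lra.
- by move=> j; rewrite le_max lexx orbT.
- by move=> j /fi ->; rewrite oppr0 maxxx.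
- by move=> j; rewrite le_max lexx orbT.
- by move=> j /fi ->; rewrite maxxx.
Qed.

Fact delta_subproof (i : I) : (fun j => (j == i)%:R) \in @ell2_pred R I.
Proof.
apply: mem_set => /=; rewrite (@nnsum_single _ i) ?ltry// => j.
  exact: abs2_ge0.
by move=> /negPf ->; rewrite /abs2/= expr0n addr0.
Qed.

Definition delta (i : I) : ell2 R I := Ell2 (delta_subproof i).

Lemma inner_delta (x : ell2 R I) i : inner x (delta i) = x i.
Proof.
rewrite inner_ell2E /csum !(@rsum_single _ i)/= ?eqxx ?conjC1 ?mulr1.
- by case: (x i).
- by move=> j /negPf ->; rewrite conjC0 mulr0.
- by move=> j /negPf ->; rewrite conjC0 mulr0.
Qed.

Lemma delta_orthonormal i j : inner (delta i) (delta j) = (i == j)%:R.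
Proof. by rewrite inner_delta /= eq_sym. Qed.

(** By Pythagoras, the squared distance from [x] to a truncation is the tail of the sum of |x_i|^2;
    the finite set is chosen to make it less than e^2. *)
Lemma delta_total : total_set (range delta).
Proof.
move=> F [[F0 FL] Fc] FT x; apply: Fc => e e0.
pose f i := abs2 (x i).
have f0 i : 0 <= f i by exact: abs2_ge0.
have ffin : nnsum f \is a fin_num by rewrite nnsum_fin//; exact: ell2P.
have [A fA Ae] : exists2 A : set I, finite_set A &
    fine (nnsum f) - e ^+ 2 < \sum_(i <- finmap.enum_fset (fset_set A)) f i.
  apply: contrapT => nA.
  have : (nnsum f <= (fine (nnsum f) - e ^+ 2)%:E)%E.
    apply/nnsum_fsetP => A fA; rewrite leNgt; apply/negP => h.
    by apply: nA; exists A => //; rewrite fsbig_finite// in h.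
  by rewrite -{1}(fineK ffin) lee_fin lerDl oppr_ge0 leNgt exprn_gt0.
set s := finmap.enum_fset _ in Ae.
have us : uniq s by exact: finmap.fset_uniq.
pose y := \sum_(i <- s) x i *: delta i.
have yi i : i \in s -> inner y (delta i) = x i.
  move=> is_.
  rewrite inner_suml (bigD1_seq i)//= innerZl delta_orthonormal eqxx.
  rewrite mulr1 big1 ?addr0// => j ji.
  by rewrite innerZl delta_orthonormal (negPf ji) mulr0.
have xyy : inner (x - y) y = 0.
  rewrite {2}/y inner_sumr big_seq big1// => i is_.
  rewrite innerZr -scaleN1r innerDl innerZl yi// inner_delta mulN1r subrr.
  by rewrite mulr0.
have xy : inner (x - y) (x - y) = inner x x - (\sum_(i <- s) f i)%:C%C.
  rewrite -{2}scaleN1r innerDr innerZr xyy mulr0 addr0.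
  rewrite -scaleN1r innerDl innerZl mulN1r; congr (_ - _).
  rewrite /y inner_suml rmorph_sum; apply: eq_bigr => i _ /=.
  by rewrite innerZl innerC inner_delta /f abs2E normCK.
exists y.
  rewrite /y; elim: (s) => [|i t IH]; first by rewrite big_nil.
  by rewrite big_cons; apply: FL => //; apply: FT; exists i.
rewrite -(@ltr_pXn2r _ 2)// ?nnegrE ?rnorm_ge0 ?(ltW e0)//.
rewrite -ltcR -inner_rnorm xy (ell2_innerE x : inner x x = _) -rmorphB ltcR.
by rewrite ltrBlDr -ltrBlDl.
Qed.

End one_index_set.

(** A space and its conjugate have the same closed subspaces, since [a] acts on one as its conjugate
    acts on the other. *)
Lemma conjugate_total (V : hilbertType R) (E : set V) :
  total_set E -> @total_set R (conjugate V) E.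
Proof.
move=> Et F [[F0 FL] Fc] EF z; apply: (Et F) => //; split; first split=> //.
  move=> a x y Fx Fy; have := FL a^* x y Fx Fy.
  by rewrite -[_ *: _]/(a^*^* *: x) conjCK.
move=> x xF; apply: Fc => e /xF[y Fy xy]; exists y => //.
by rewrite (rnorm_conjugate (x - y)).
Qed.

End ell2_basis.

(** * Norms of tensor operators in coordinates *)

Section tensor_coordinates.
Variable R : realType.
Local Notation C := R[i].

Lemma bop_sumE (V W : normedModType C) (J : Type) (s : seq J)
    (X : J -> bop V W) z :
  (\sum_(t <- s) X t) z = \sum_(t <- s) X t z.
Proof. by elim/big_ind2: _ => // ? x ? y <- <-. Qed.

Lemma sum_ord_pad (V : nmodType) n m (F : nat -> V) : (n <= m)%N ->
  \sum_(j < m) (if (j < n)%N then F j else 0) = \sum_(j < n) F j.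
Proof. by move=> nm; rewrite -big_mkcond (big_ord_widen m F nm). Qed.

Lemma total_setT (V : normedModType C) : total_set [set: V].
Proof. by move=> F _ TF z; exact: TF. Qed.

Section coordinates_right.
Variables (H K : hilbertType R) (P : hilbertTensor H K) (e : nat -> K).
Hypothesis eo : forall i j, inner (e i) (e j) = (i == j)%:R.
Hypothesis et : total_set (range e).
Local Notation "h ⊗ k" := (ht_tens P h k) (at level 35).

(** Only [K] gets coordinates, because [H] will be the arbitrary Hilbert space on which OH is
    realized. Families are indexed by [nat] so that zero padding gives two vectors a common
    length. *)
Let D (z : P) := exists n (h : nat -> H), z = \sum_(j < n) h j ⊗ e j.

Let D_widen n m (h : nat -> H) : (n <= m)%N ->
  exists h' : nat -> H, \sum_(j < n) h j ⊗ e j = \sum_(j < m) h' j ⊗ e j.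
Proof.
move=> nm; exists (fun j => if (j < n)%N then h j else 0).
rewrite -(sum_ord_pad (fun j => h j ⊗ e j) nm); apply: eq_bigr => j _.
by case: ifP => // _; rewrite linear0l.
Qed.

Let D_linear : linear_subspace D.
Proof.
split=> [|a _ _ [n [h ->]] [m [g ->]]].
  by exists 0, (fun=> 0); rewrite big_ord0.
have [h' ->] := D_widen h (leq_maxl n m).
have [g' ->] := D_widen g (leq_maxr n m).
exists (maxn n m), (fun j => a *: h' j + g' j).
rewrite scaler_sumr -big_split; apply: eq_bigr => j _ /=.
by rewrite linearPl.
Qed.

Let D_dense z (r : R) : 0 < r -> exists2 x, D x & rnorm (z - x) < r.
Proof.
have tt := tensor_total (P := P) (@total_setT H) et.
apply: (total_dense z tt D_linear) => {r}.
move=> _ [h [_ [_ [n _ <-] ->]]].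
(* Length n + 1, so that the index n itself occurs, as the last one. *)
exists n.+1, (fun j => if j == n then h else 0).
rewrite big_ord_recr/= eqxx big1 ?add0r// => j _.
by rewrite ltn_eqF// linear0l.
Qed.

Lemma inner_coordinates n (h g : 'I_n -> H) :
  inner (\sum_j h j ⊗ e j) (\sum_j g j ⊗ e j) = \sum_j inner (h j) (g j).
Proof.
rewrite (inner_sum_tens P h g (fun j => e j) (fun j => e j)).
apply: eq_bigr => j _; rewrite (bigD1 j)//= eo eqxx mulr1 big1 ?addr0// => i ij.
by rewrite eo [_ == _](negPf (_ : (j != i))) ?mulr0// eq_sym.
Qed.

(** The sums of h_j ⊗ e_j with j < n form a copy of the direct sum of n copies of [H], on which the
    compression of the operator is the displayed matrix. These subspaces increase to a dense one. *)
Lemma opnorm_sum_tensor_op_leP (J : Type) (s : seq J)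
    (A : J -> bop H H) (a : J -> bop K K) (M : R) : 0 <= M ->
  opnorm (\sum_(t <- s) tensor_op P (A t) (a t)) <= M <->
  forall n, (bop_mxnorms (\matrix_(i < n, j < n)
    (\sum_(t <- s) inner (a t (e j)) (e i) *: A t)%R) <= M%:E)%E.
Proof.
move=> M0; set X := \sum_(t <- s) _.
have XE n (h g : 'I_n -> H) :
    inner (X (\sum_j h j ⊗ e j)) (\sum_i g i ⊗ e i) =
    \sum_i \sum_j inner ((\matrix_(i < n, j < n)
      \sum_(t <- s) inner (a t (e j)) (e i) *: A t) i j (h j)) (g i).
  rewrite bop_sumE inner_suml.
  transitivity (\sum_(t <- s) \sum_(i < n) \sum_(j < n)
      inner (a t (e j)) (e i) * inner (A t (h j)) (g i)).
    apply: eq_bigr => t _; rewrite linear_sum.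
    rewrite (eq_bigr (fun j => A t (h j) ⊗ a t (e j))); last first.
      by move=> j _; exact: tensor_opE.
    rewrite (inner_sum_tens P (fun j => A t (h j)) g
      (fun j => a t (e j)) (fun j => e j)).
    by rewrite exchange_big; do 2 apply: eq_bigr => ? _; rewrite mulrC.
  rewrite exchange_big; apply: eq_bigr => i _; rewrite exchange_big.
  apply: eq_bigr => j _; rewrite mxE bop_sumE inner_suml.
  by apply: eq_bigr => t _; rewrite -innerZl.
split=> [XM n|H'].
  apply/bop_mxnorms_leP => // h g; rewrite -XE -!inner_coordinates.
  apply: (proj1 (@dense_opnorm_leP R P setT X M _ M0)) => //.
  by move=> z r r0; exists z => //; rewrite subrr rnorm0.
apply/(dense_opnorm_leP _ D_dense) => // _ _ [n [h ->]] [m [g ->]].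
have [h' ->] := D_widen h (leq_maxl n m).
have [g' ->] := D_widen g (leq_maxr n m).
have := proj1 (bop_mxnorms_leP _ M0) (H' (maxn n m))
  [ffun j => h' (val j)] [ffun j => g' (val j)].
have fE (u : nat -> H) : \sum_(j < maxn n m) [ffun j => u (val j)] j ⊗ e j =
    \sum_(j < maxn n m) u j ⊗ e j by apply: eq_bigr => j _; rewrite ffunE.
by rewrite -XE -!inner_coordinates !fE.
Qed.

End coordinates_right.
Section coordinates_both.
Variables (H K : hilbertType R) (Q : hilbertTensor H K).
Variables (e : nat -> H) (f : nat -> K).
Hypothesis eo : forall i j, inner (e i) (e j) = (i == j)%:R.
Hypothesis fo : forall i j, inner (f i) (f j) = (i == j)%:R.
Hypothesis et : total_set (range e).
Hypothesis ft : total_set (range f).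
Local Notation "h ⊗ k" := (ht_tens Q h k) (at level 35).

Let vec n (c : nat -> nat -> C) : Q :=
  \sum_(p : 'I_n * 'I_n) c p.1 p.2 *: (e p.1 ⊗ f p.2).

Let D (z : Q) := exists n (c : nat -> nat -> C), z = vec n c.

Let vecE n c : vec n c = \sum_(i < n) \sum_(j < n) c i j *: (e i ⊗ f j).
Proof. by rewrite pair_bigA. Qed.

Let D_widen n m c : (n <= m)%N -> exists c', vec n c = vec m c'.
Proof.
move=> nm.
exists (fun i j => if (i < n)%N then if (j < n)%N then c i j else 0 else 0).
rewrite !vecE.
rewrite -(sum_ord_pad (fun i => \sum_(j < n) c i j *: (e i ⊗ f j)) nm).
apply: eq_bigr => i _; case: ifP => _; last first.
  by rewrite big1// => j _; rewrite scale0r.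
rewrite -(sum_ord_pad (fun j => c i j *: (e i ⊗ f j)) nm).
by apply: eq_bigr => j _; case: ifP => // _; rewrite scale0r.
Qed.

Let D_linear : linear_subspace D.
Proof.
split=> [|a _ _ [n [c ->]] [m [d ->]]].
  by exists 0, (fun _ _ => 0); rewrite vecE big_ord0.
have [c' ->] := D_widen c (leq_maxl n m).
have [d' ->] := D_widen d (leq_maxr n m).
exists (maxn n m), (fun i j => a * c' i j + d' i j).
rewrite /vec scaler_sumr -big_split; apply: eq_bigr => p _ /=.
by rewrite scalerDl scalerA.
Qed.

Let D_dense z (r : R) : 0 < r -> exists2 x, D x & rnorm (z - x) < r.
Proof.
apply: (total_dense z (tensor_total (P := Q) et ft) D_linear) => {r}.
move=> _ [_ [_ [[i _ <-] [j _ <-] ->]]].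
pose n := (maxn i j).+1; have ilt : (i < n)%N by rewrite ltnS leq_maxl.
have jlt : (j < n)%N by rewrite ltnS leq_maxr.
exists n, (fun k l => ((k == i) && (l == j))%:R).
rewrite /vec (bigD1 (Ordinal ilt, Ordinal jlt))//= !eqxx scale1r big1 ?addr0//.
move=> [k l] /= kl; rewrite (_ : _ && _ = false) ?scale0r//.
apply: contraNF kl => /andP[/eqP ki /eqP lj].
by apply/eqP; congr pair; exact: val_inj.
Qed.

Lemma inner_vec n (c d : 'I_n * 'I_n -> C) :
  inner (\sum_p c p *: (e p.1 ⊗ f p.2)) (\sum_p d p *: (e p.1 ⊗ f p.2)) =
  \sum_p c p * (d p)^*.
Proof.
rewrite inner_lincomb; apply: eq_bigr => p _; rewrite (bigD1 p)//=.
rewrite ht_inner eo fo !eqxx !mulr1 big1 ?addr0// => q qp.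
rewrite ht_inner eo fo -natrM mulnb (_ : _ && _ = false) ?mulr0//.
apply: contraNF qp => /andP[/eqP h1 /eqP h2].
case: p q h1 h2 => [? ?] [? ?] /= h1 h2.
by apply/eqP; congr pair; exact/esym/val_inj.
Qed.

(** As the e_i ⊗ f_j are orthonormal, a finite combination of them is a coefficient matrix with its
    Hilbert-Schmidt norm; this matches the vectors on which [gram_form] acts. *)
Lemma opnorm_sum_tensor_op_bilinear_leP (J : Type) (s : seq J)
    (a : J -> bop H H) (b : J -> bop K K) (M : R) : 0 <= M ->
  opnorm (\sum_(t <- s) tensor_op Q (a t) (b t)) <= M <->
  forall n (h g : 'M[C]_n),
    `|\sum_(p : 'I_n * 'I_n) \sum_(q : 'I_n * 'I_n) h p.1 p.2 * (g q.1 q.2)^* *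
        \sum_(t <- s) inner (a t (e p.1)) (e q.1) * inner (b t (f p.2)) (f q.2)|
      ^+ 2 <= (M ^+ 2)%:C%C * (sqnorm_mx h * sqnorm_mx g).
Proof.
move=> M0; set X := \sum_(t <- s) _.
have XE n (c d : 'I_n * 'I_n -> C) :
    inner (X (\sum_p c p *: (e p.1 ⊗ f p.2))) (\sum_p d p *: (e p.1 ⊗ f p.2)) =
    \sum_p \sum_q c p * (d q)^* *
      \sum_(t <- s) inner (a t (e p.1)) (e q.1) * inner (b t (f p.2)) (f q.2).
  rewrite linear_sum (eq_bigr (fun p => c p *: X (e p.1 ⊗ f p.2))); last first.
    by move=> p _; rewrite linearZ.
  rewrite inner_lincomb; apply: eq_bigr => p _; apply: eq_bigr => q _.
  congr (_ * _); rewrite bop_sumE inner_suml; apply: eq_bigr => t _.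
  by rewrite tensor_opE ht_inner.
have sqE n (h : 'M[C]_n) : sqnorm_mx h = \sum_p h p.1 p.2 * (h p.1 p.2)^*.
  by rewrite /sqnorm_mx pair_bigA; apply: eq_bigr => p _; rewrite normCK.
split=> [XM n h g|XM].
  rewrite !sqE -(XE n (fun p => h p.1 p.2) (fun p => g p.1 p.2)).
  rewrite -(inner_vec (fun p => h p.1 p.2) (fun p => h p.1 p.2)).
  rewrite -(inner_vec (fun p => g p.1 p.2) (fun p => g p.1 p.2)).
  apply: (proj1 (@dense_opnorm_leP R Q setT X M _ M0)) => //.
  by move=> z r r0; exists z => //; rewrite subrr rnorm0.
apply/(dense_opnorm_leP _ D_dense) => // _ _ [n [c ->]] [m [d ->]].
have [c' ->] := D_widen c (leq_maxl n m).
have [d' ->] := D_widen d (leq_maxr n m).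
have mE (u v : nat -> nat -> C) : \sum_(p : 'I_(maxn n m) * 'I_(maxn n m))
    (\matrix_(i, j) u i j : 'M_(maxn n m)) p.1 p.2 *:
      (e p.1 ⊗ f p.2) = vec (maxn n m) u.
  by apply: eq_bigr => p _; rewrite mxE.
have := XM _ (\matrix_(i, j) c' i j : 'M_(maxn n m)) (\matrix_(i, j) d' i j).
rewrite !sqE -(XE _ (fun p => (\matrix_(i, j) c' i j : 'M_(maxn n m)) p.1 p.2)
  (fun p => (\matrix_(i, j) d' i j : 'M_(maxn n m)) p.1 p.2)).
rewrite -(inner_vec (fun p => (\matrix_(i, j) c' i j : 'M_(maxn n m)) p.1 p.2)
  (fun p => (\matrix_(i, j) c' i j : 'M_(maxn n m)) p.1 p.2)).
rewrite -(inner_vec (fun p => (\matrix_(i, j) d' i j : 'M_(maxn n m)) p.1 p.2)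
  (fun p => (\matrix_(i, j) d' i j : 'M_(maxn n m)) p.1 p.2)).
by rewrite !mE.
Qed.

End coordinates_both.
End tensor_coordinates.

(** * Finite supports and the comparison of the two norms *)

Lemma inner_orthonormal_sum (R : realType) (V : hilbertType R) (I : choiceType)
    (T : I -> V) (s : seq I) (c d : I -> R[i]) :
  (forall i j, inner (T i) (T j) = (i == j)%:R) -> uniq s ->
  inner (\sum_(t <- s) c t *: T t) (\sum_(t <- s) d t *: T t) =
  \sum_(t <- s) c t * (d t)^*.
Proof.
move=> To us; rewrite inner_lincomb; apply: eq_big_seq => t ts.
rewrite (bigD1_seq t)//= To eqxx mulr1 big1 ?addr0// => u ut.
by rewrite To eq_sym (negPf ut) mulr0.
Qed.

Lemma min_norm_finite (R : realType) (E F : normedModType R[i])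
    (SE : opSpace E) (SF : opSpace F)
    (P : hilbertTensor (os_hilbert SE) (os_hilbert SF))
    (I : choiceType) (x : I -> E) (y : I -> F) (s : seq I) : uniq s ->
  (forall i, i \notin s -> y i = 0) ->
  min_norm SE SF P x y =
  (opnorm (\sum_(i <- s) tensor_op P (os_emb SE (x i)) (os_emb SF (y i))))%:C%C.
Proof.
move=> us sy; rewrite /min_norm (fsbigE s)//.
  by rewrite (eq_bigl xpredT)// => i; rewrite in_setT.
by move=> i _ /sy ->; rewrite linear0 tensor_op0.
Qed.

Theorem mainTheorem2 (R : realType) (I : choiceType) (OH : hilbertType R)
  (S : opSpace OH) (hOH : is_OH I S)
  (T : I -> OH) (hT : orthonormal_basis T)
  (a : I -> bop (ell2 R nat) (ell2 R nat)) (ha : finite_set [set i | a i != 0])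
  (P : hilbertTensor (os_hilbert S) (ell2 R nat))
  (Q : hilbertTensor (ell2 R nat) (conjugate (ell2 R nat))) :
  min_norm S (bop_opSpace (ell2 R nat)) P T a =
  sqrtC (min_norm (bop_opSpace (ell2 R nat))
                  (bop_opSpace (conjugate (ell2 R nat)))
                  Q a (fun i => conj_op (a i))).
Proof.
pose s : seq I := finmap.enum_fset (fset_set [set i | a i != 0]).
have us : uniq s by exact: finmap.fset_uniq.
have sa i : i \notin s -> a i = 0.
  rewrite /s in_fset_set// => /negP; rewrite inE /= => /negP.
  by rewrite negbK => /eqP.
rewrite (min_norm_finite _ _ us sa) (min_norm_finite _ _ us); last first.
  by move=> i /sa ->; exact/val_inj.
set X := \sum_(i <- s) _; set Y := \sum_(i <- s) _.
pose e := @delta R nat.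
pose x n : 'M[OH]_n :=
  \matrix_(i, j) \sum_(t <- s) inner (a t (e j)) (e i) *: T t.
have eo i j : inner (e i) (e j) = (i == j)%:R by exact: delta_orthonormal.
have et : total_set (range e) by exact: delta_total.
have XE M : 0 <= M ->
    opnorm X <= M <-> forall n, (os_mxnorms S (x n) <= M%:E)%E.
  move=> M0; apply: iff_trans (@opnorm_sum_tensor_op_leP R _ _ P e eo et I s
    (fun t => os_emb S (T t)) a M M0) _.
  suff emb n : map_mx (os_emb S) (x n) =
      \matrix_(i < n, j < n)
        \sum_(t <- s) inner (a t (e j)) (e i) *: os_emb S (T t).
    by split=> H n; have := H n; rewrite /os_mxnorms emb.
  apply/matrixP => i j; rewrite !mxE linear_sum.
  by apply: eq_bigr => t _; rewrite linearZ.
have YE M : 0 <= M -> opnorm Y <= M <-> forall n,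
    gram_bounded (x n) (x n) (M ^+ 2)%:C%C.
  move=> M0.
  have fo i j : inner (e i : conjugate (ell2 R nat)) (e j) = (i == j)%:R.
    by rewrite inner_conjugateE eo eq_sym.
  apply: iff_trans (@opnorm_sum_tensor_op_bilinear_leP R _ _ Q e e eo
    fo et (conjugate_total et) I s a (fun t => conj_op (a t)) M M0) _.
  have gE n (h g : 'M[R[i]]_n) : gram_form (x n) (x n) h g =
      \sum_(p : 'I_n * 'I_n) \sum_(q : 'I_n * 'I_n) h p.1 p.2 * (g q.1 q.2)^* *
        \sum_(t <- s) inner (a t (e p.1)) (e q.1) *
          inner (conj_op (a t) (e p.2)) (e q.2 : conjugate (ell2 R nat)).
    (* With p = (j, l) and q = (i, k), orthonormality makes <x_ij, x_kl> the sum over t of <a_t e_j,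
       e_i> times the conjugate of <a_t e_l, e_k>; that conjugate is the corresponding entry of the
       conjugate operator. *)
    rewrite gram_formE pair_bigA [RHS]exchange_big; apply: eq_bigr => q _.
    rewrite pair_bigA; apply: eq_bigr => p _ /=.
    rewrite !mxE inner_orthonormal_sum//; last exact: (proj1 hT).
    rewrite -mulrA mulrC; congr (_ * _); apply: eq_bigr => t _.
    by rewrite inner_conjugateE -innerC.
  by split=> H n h g; [rewrite gE|rewrite -gE]; exact: H.
have XY M : 0 < M -> opnorm X <= Num.sqrt M <-> opnorm Y <= M.
  move=> M0; apply: iff_trans (XE _ (sqrtr_ge0 M)) _.
  apply: iff_trans (iff_sym (YE _ (ltW M0))).
  by split=> H n; apply/(OH_mxnorm_gramP hOH).
have X0 := opnorm_ge0 X; have Y0 := opnorm_ge0 Y.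
suff -> : opnorm Y = opnorm X ^+ 2.
  by rewrite rmorphXn sqrCK// ler0c.
(* [XY] covers positive bounds only, so each inequality is proved up to r > 0, with bounds |X|^2 + r
   and |Y| + r; this includes the case of norm 0. *)
apply/eqP; rewrite eq_le; apply/andP; split; apply/ler_addgt0Pr => r r0.
  apply/XY; first by rewrite ltr_wpDl// exprn_ge0.
  rewrite -[leLHS]ger0_norm// -sqrtr_sqr ler_sqrt ?lerDl ?(ltW r0)//.
  by rewrite addr_ge0 ?exprn_ge0// ltW.
have Yr : 0 < opnorm Y + r by rewrite ltr_wpDl.
have /(XY _ Yr) XYr : opnorm Y <= opnorm Y + r by rewrite lerDl ltW.
rewrite -[leRHS]sqr_sqrtr ?(ltW Yr)//.
by rewrite lerXn2r// nnegrE// sqrtr_ge0.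
Qed.
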